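(* Let $r>d/2$. There is a constant $C>0$ depending on $r,d$, but not on $f$, $n$, $\kappa$ or $(\mathcal X,\tau)$, such that the following holds. Suppose that $(\mathcal X,\tau)$ is an $L_2$-Marcinkiewicz-Zygmund family on $\mathbb S^d$ with global condition number $\kappa$, and let $L_{n,2}^{\mathbb S}$ and $I_n^{\mathbb S}$ be the associated weighted least squares approximation and least squares quadrature, respectively. Then for every $f\in H^r(\mathbb S^d)\equiv W_2^r(\mathbb S^d)$ and every $n\ge1$, $$\|f-L_{n,2}^{\mathbb S}(f)\|_2\le C(1+\kappa^{1/2})n^{-r}\|f\|_{H^r(\mathbb S^d)}$$ and $$\Big|\int_{\mathbb S^d}f(x)d\sigma(x)-I_n^{\mathbb S}(f)\Big|\le C(1+\kappa^{1/2})n^{-r}\|f\|_{H^r(\mathbb S^d)}.$$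
   Context: $\mathbb S^d$ is the unit sphere of $\mathbb R^{d+1}$, $\sigma$ the rotation invariant measure on it normalized by $\sigma(\mathbb S^d)=1$, and $L_2(\mathbb S^d)=L_2(\mathbb S^d,d\sigma)$ with norm $\|f\|_2=\big(\int_{\mathbb S^d}|f|^2d\sigma\big)^{1/2}$. $\Pi_n(\mathbb S^d)$ is the space of (real) spherical polynomials of degree at most $n$ (restrictions to $\mathbb S^d$ of polynomials in $d+1$ variables of total degree at most $n$), and $\mathcal H_k(\mathbb S^d)$ is the space of spherical harmonics of degree $k$. Sobolev space: $H_k$ is the orthogonal projector of $L_2(\mathbb S^d)$ onto $\mathcal H_k(\mathbb S^d)$. For $r>0$, $(-\triangle_0)^{r/2}f=\sum_{k\ge0}(k(k+d-1))^{r/2}H_kf$ (in the sense of distributions; $\triangle_0$ is the Laplace–Beltrami operator), and $H^r(\mathbb S^d)=W_2^r(\mathbb S^d)=\{f\in L_2(\mathbb S^d):\|f\|_{H^r(\mathbb S^d)}:=\|f\|_2+\|(-\triangle_0)^{r/2}f\|_2<\infty\}$. If $r>d/2$, it embeds (compactly) into $C(\mathbb S^d)$, and elements are identified with their continuous representatives. MZ family: let $\mathcal X=\{x_{n,k}:k=1,\dots,l_n,\ n=1,2,\dots\}$ be points in $\mathbb S^d$ and $\tau=\{\tau_{n,k}:k=1,\dots,l_n,\ n=1,2,\dots\}$ positive numbers, where $l_n\to\infty$ as $n\to\infty$. $(\mathcal X,\tau)$ is an $L_2$-Marcinkiewicz-Zygmund family on $\mathbb S^d$ if there are $A,B>0$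 independent of $n$ such that $A\|P\|_2^2\le\sum_{k=1}^{l_n}|P(x_{n,k})|^2\tau_{n,k}\le B\|P\|_2^2$ for all $P\in\Pi_n(\mathbb S^d)$, $n\ge1$; its global condition number is $\kappa=B/A$. Weighted least squares approximation: for $f\in C(\mathbb S^d)$, $L_{n,2}^{\mathbb S}(f)$ is the unique element of $\Pi_n(\mathbb S^d)$ minimizing $\sum_{k=1}^{l_n}|f(x_{n,k})-P(x_{n,k})|^2\tau_{n,k}$ over $P\in\Pi_n(\mathbb S^d)$; equivalently $L_{n,2}^{\mathbb S}(f)(x)=\sum_{k=1}^{l_n}\tau_{n,k}f(x_{n,k})D_n^{\mathbb S}(x,x_{n,k})$, where $D_n^{\mathbb S}$ is the reproducing kernel of $\Pi_n(\mathbb S^d)$ for the inner product $\langle f,g\rangle_{[2]}=\sum_{k=1}^{l_n}\tau_{n,k}f(x_{n,k})g(x_{n,k})$. Least squares quadrature: $I_n^{\mathbb S}(f)=\sum_{k=1}^{l_n}W_{n,k}f(x_{n,k})$ with $W_{n,k}=\tau_{n,k}\int_{\mathbb S^d}D_n^{\mathbb S}(x,x_{n,k})d\sigma(x)$; equivalently $I_n^{\mathbb S}(f)=\int_{\mathbb S^d}L_{n,2}^{\mathbb S}(f)(x)d\sigma(x)$. *)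

(* Defs.v *)
From HB Require Import structures.
From mathcomp Require Import all_boot all_order all_algebra.
From mathcomp Require Import all_classical all_reals all_analysis.
(* The notations of mpoly clash with those of analysis. *)
From mathcomp Require mpoly.
Import (canonicals, coercions) mpoly.

Set Implicit Arguments.
Unset Strict Implicit.
Unset Printing Implicit Defensive.

Import Order.TTheory GRing.Theory Num.Theory.
Import numFieldNormedType.Exports.

Local Open Scope classical_set_scope.
Local Open Scope ring_scope.

(* The norm of the library on 'rV[R]_d.+1 is the sup norm, so the Euclidean
   unit sphere S^d of R^(d+1) is given by its equation. *)
Definition sphere (R : realType) (d : nat) : Type :=
  {x : 'rV[R]_d.+1 | \sum_(i < d.+1) x 0 i ^+ 2 == 1}.

Definition sphere_val {R : realType} {d : nat} (x : sphere R d) : 'rV[R]_d.+1 :=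
  sval x.

Lemma north_pole_subproof (R : realType) (d : nat) :
  \sum_(i < d.+1) (delta_mx 0 0 : 'rV[R]_d.+1) 0 i ^+ 2 == 1.
Proof.
rewrite (bigD1 ord0) //= mxE !eqxx expr1n big1 ?addr0 // => i i0.
by rewrite mxE (negbTE i0) andbF expr0n.
Qed.

HB.instance Definition _ (R : realType) (d : nat) := Choice.on (sphere R d).
HB.instance Definition _ (R : realType) (d : nat) :=
  isPointed.Build (sphere R d)
    (exist (fun x : 'rV[R]_d.+1 => \sum_(i < d.+1) x 0 i ^+ 2 == 1) _
     (north_pole_subproof R d)).
HB.instance Definition _ (R : realType) (d : nat) :=
  Topological.copy (sphere R d) (initial_topology (@sphere_val R d)).
(* Borel sigma-algebra *)
HB.instance Definition _ (R : realType) (d : nat) :=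
  Measurable.copy (sphere R d)
    (g_sigma_algebraType [set U : set (sphere R d) | open U]).

(* Invariance under SO(d+1), acting on row vectors by right multiplication.
   There is exactly one such probability measure when 0 < d. *)
Definition rotation_invariant (R : realType) (d : nat)
    (sigma : probability (sphere R d) R) : Prop :=
  forall U : 'M[R]_d.+1, U *m U^T = 1%:M -> \det U = 1 ->
  forall A : set (sphere R d), measurable A ->
  sigma [set x | exists2 y, A y & sphere_val y = sphere_val x *m U] = sigma A.

Definition sphere_eval {R : realType} {d : nat} (p : mpoly.mpoly d.+1 R)
    (x : sphere R d) : R :=
  mpoly.meval (fun i => sphere_val x 0 i) p.

(* msize is the total degree plus one, and 0 for the zero polynomial. *)
Definition spherical_polynomials (R : realType) (d n : nat) :
    set (sphere R d -> R) :=
  [set P | exists2 p : mpoly.mpoly d.+1 R,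
      (mpoly.msize p <= n.+1)%N & P = sphere_eval p].

Definition spherical_harmonics (R : realType) (d k : nat) :
    set (sphere R d -> R) :=
  [set Y | exists p : mpoly.mpoly d.+1 R,
      [/\ p \is mpoly.ishomog1 k mpoly.mdeg,
          \sum_(i < d.+1) mpoly.mderiv i (mpoly.mderiv i p) = 0
        & Y = sphere_eval p]].

Definition l2norm {R : realType} {d : nat} (sigma : probability (sphere R d) R)
    (f : sphere R d -> R) : \bar R :=
  ('N[sigma]_(2%:E) [EFin \o f])%E.

(* The orthogonal projection onto the (finite-dimensional) space of spherical
   harmonics of degree k; it exists and is unique for f in L_2. *)
Definition harmonic_proj {R : realType} {d : nat}
    (sigma : probability (sphere R d) R) (k : nat) (f : sphere R d -> R) :
    sphere R d -> R :=
  xget (cst 0) [set Y | spherical_harmonics k Y /\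
    forall Z, spherical_harmonics k Z ->
      \int[sigma]_x ((f x - Y x) * Z x) = 0].

Definition partial {R : realType} {d : nat} (i : 'I_d.+1)
    (F : 'rV[R]_d.+1 -> R) : 'rV[R]_d.+1 -> R :=
  fun x => 'D_(delta_mx 0 i) F x.

Definition smooth {R : realType} {d : nat} (F : 'rV[R]_d.+1 -> R) : Prop :=
  forall s : seq 'I_d.+1,
    continuous (foldr partial F s) /\
    forall (i : 'I_d.+1) (x : 'rV[R]_d.+1),
      derivable (foldr partial F s) x (delta_mx 0 i).

(* S^d being a closed submanifold of R^(d+1), its smooth functions are the
   restrictions of the smooth functions on R^(d+1). *)
Definition smooth_on_sphere {R : realType} {d : nat} (phi : sphere R d -> R) :
    Prop :=
  exists2 F : 'rV[R]_d.+1 -> R, smooth F & phi = F \o sphere_val.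

(* The distribution (- Delta_0)^(r/2) f, i.e.
   sum_k (k (k + d - 1))^(r/2) H_k f, is represented by the function g. *)
Definition is_frac_laplacian {R : realType} {d : nat}
    (sigma : probability (sphere R d) R) (r : R) (f g : sphere R d -> R) :
    Prop :=
  forall phi, smooth_on_sphere phi ->
    series (fun k => (k%:R * (k%:R + d%:R - 1)) `^ (r / 2) *
                     \int[sigma]_x (harmonic_proj sigma k f x * phi x))
      @ \oo --> \int[sigma]_x (g x * phi x).

(* ||f||_2 + ||(- Delta_0)^(r/2) f||_2. All the g below are equal almost
   everywhere; the infimum is +oo when (- Delta_0)^(r/2) f is not in L_2. *)
Definition sobolev_norm {R : realType} {d : nat}
    (sigma : probability (sphere R d) R) (r : R) (f : sphere R d -> R) :
    \bar R :=
  (l2norm sigma f +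
   ereal_inf [set l2norm sigma g |
     g in [set g | g \in Lfun sigma 2%:E /\ is_frac_laplacian sigma r f g]])%E.

Definition sobolev {R : realType} {d : nat}
    (sigma : probability (sphere R d) R) (r : R) : set (sphere R d -> R) :=
  [set f | f \in Lfun sigma 2%:E /\ (sobolev_norm sigma r f < +oo)%E].

(* Only the rows n >= 1 of the arrays matter. *)
Definition MZ_family {R : realType} {d : nat}
    (sigma : probability (sphere R d) R) (l : nat -> nat)
    (x : forall n, 'I_(l n) -> sphere R d) (tau : forall n, 'I_(l n) -> R)
    (A B : R) : Prop :=
  [/\ l @ \oo --> \oo,
      forall n (k : 'I_(l n)), (0 < n)%N -> 0 < tau n k,
      0 < A, 0 < B
    & forall n P, (0 < n)%N -> spherical_polynomials n P ->
        (A%:E * l2norm sigma P ^+ 2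
           <= (\sum_(k < l n) `|P (x n k)| ^+ 2 * tau n k)%:E
           <= B%:E * l2norm sigma P ^+ 2)%E].

Definition lsq_error {R : realType} {d m : nat} (x : 'I_m -> sphere R d)
    (tau : 'I_m -> R) (f P : sphere R d -> R) : R :=
  \sum_(k < m) `|f (x k) - P (x k)| ^+ 2 * tau k.

(* Under the lower MZ inequality the minimizer and the kernel below exist and
   are unique as functions on the sphere, so the default values of xget are
   not used. *)
Definition lsq_approx {R : realType} {d m : nat} (n : nat)
    (x : 'I_m -> sphere R d) (tau : 'I_m -> R) (f : sphere R d -> R) :
    sphere R d -> R :=
  xget (cst 0) [set P | spherical_polynomials n P /\
    forall Q, spherical_polynomials n Q ->
      lsq_error x tau f P <= lsq_error x tau f Q].

Definition lsq_inner {R : realType} {d m : nat} (x : 'I_m -> sphere R d)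
    (tau : 'I_m -> R) (f g : sphere R d -> R) : R :=
  \sum_(k < m) tau k * f (x k) * g (x k).

(* The reproducing kernel D_n of the spherical polynomials of degree at most n
   for lsq_inner. *)
Definition lsq_kernel {R : realType} {d m : nat} (n : nat)
    (x : 'I_m -> sphere R d) (tau : 'I_m -> R) :
    sphere R d -> sphere R d -> R :=
  xget (fun _ _ => 0) [set D | forall y : sphere R d,
    spherical_polynomials n (D^~ y) /\
    forall P, spherical_polynomials n P -> P y = lsq_inner x tau P (D^~ y)].

Definition lsq_weight {R : realType} {d m : nat}
    (sigma : probability (sphere R d) R) (n : nat)
    (x : 'I_m -> sphere R d) (tau : 'I_m -> R) (k : 'I_m) : R :=
  tau k * \int[sigma]_y lsq_kernel n x tau y (x k).

Definition lsq_quadrature {R : realType} {d m : nat}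
    (sigma : probability (sphere R d) R) (n : nat)
    (x : 'I_m -> sphere R d) (tau : 'I_m -> R) (f : sphere R d -> R) : R :=
  \sum_(k < m) lsq_weight sigma n x tau k * f (x k).

(* Main.v *)
Require Import Defs.
From HB Require Import structures.
From mathcomp Require Import all_boot all_order all_algebra.
From mathcomp Require Import zify ring lra.
From mathcomp Require mpoly.

(* The least squares approximant is the projection of f onto Pi_n for the
   sampling inner product, so by the lower Marcinkiewicz-Zygmund inequality it
   is enough to bound f - S_n f in L_2 and in the sampling norm, S_n f being the
   sum of the harmonic components of f of degree at most n.  Split f - S_n f
   into the blocks Q_j of the degrees in (2^j n, 2^(j+1) n], for which
   ||Q_j||_2 <= (2^j n)^(-r) ||(- Delta_0)^(r/2) f||_2.  For p of degree at most
   N and the kernels D_n, D_(N+n) of Pi_n and Pi_(N+n), the identity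
   p(y) D_n(y,y) = <p D_n(y,.), D_(N+n)(y,.)>, the Cauchy-Schwarz inequality and
   the upper inequality for the polynomials D_n(z,.) give
   sum_k tau_k |p(x_k)|^2 <= B (dim Pi_(N+n) / dim Pi_n) ||p||_2^2.
   Hence the sampling norm of Q_j is O(2^(jd/2) (2^j n)^(-r)), which is summable
   because r > d/2.  The same geometric decay makes the partial sums converge
   uniformly; their limit is f because a continuous function orthogonal to all
   polynomials vanishes. *)

Set Implicit Arguments.
Unset Strict Implicit.
Unset Printing Implicit Defensive.

Import Order.TTheory GRing.Theory Num.Theory.
Local Open Scope ring_scope.

(** * Polynomials, reflections and orthonormalisation *)

Section PolynomialAlgebra.
Import mpoly.
Variables (R : numFieldType) (n : nat).
Implicit Types p q h : {mpoly R[n]}.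

(** The obstacle is that the upper Marcinkiewicz-Zygmund inequality says nothing about degrees above
    n, while f - S_n f has no others. The price of the detour through two kernels is a ratio of
    dimensions, for which crude bounds suffice: reduction modulo |x|^2 - 1 bounds the dimension of
    Pi_n above by 2 (n + 1)^d, and interpolation on a grid lifted to the sphere bounds it below by
    (n/d + 1)^d. Passing from n to 2^j n then costs 2^(jd) up to a constant in d, uniformly in n.
    The facts on harmonics all come from rotation invariance. Comparing coefficients of u in the
    integral of p along a rational parametrisation of the plane rotations shows that x_i d_j - x_j
    d_i is antisymmetric. The squares of these operators sum to twice the Laplace-Beltrami operator,
    so harmonics of different degrees are orthogonal as eigenvectors. Invariance and transitivity
    also make D_n(y,y) constant, hence equal to the dimension. Finally, (-Delta_0)^(r/2) f is known
    only through its values on test functions, so the blocks are bounded by duality, testing it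
    against harmonic polynomials. *)

Lemma mpoly_ring_ind (P : {mpoly R[n]} -> Prop) :
  (forall c, P c%:MP) -> (forall i, P 'X_i) ->
  (forall p q, P p -> P q -> P (p + q)) ->
  (forall p q, P p -> P q -> P (p * q)) -> forall p, P p.
Proof.
move=> PC PX PD PM; apply: mpolyind => [|c m p _ _ Pp].
  by rewrite -mpolyC0; exact: PC.
apply: PD Pp; rewrite -mul_mpolyC; apply: (PM) => //.
rewrite mpolyXE_id; elim/big_rec: _ => [|i q _ Pq]; first exact: PC.
apply: (PM) => //; elim: (m i) => [|k IHk]; first exact: PC.
by rewrite exprS; exact: (PM).
Qed.

Lemma mderivXU i j : ('X_j : {mpoly R[n]})^`M(i) = (i == j)%:R.
Proof.
rewrite mderivX mnmE eq_sym; case: eqVneq => [->|_]; last by rewrite scale0r.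
have -> : (U_(j) - U_(j) = 0)%MM by apply/mnmP => k; rewrite mnmBE subnn mnm0E.
by rewrite mpolyX0 scale1r.
Qed.

Definition mlaplacian p := \sum_(i < n) p^`M(i)^`M(i).
Definition sqnorm_mpoly : {mpoly R[n]} := \sum_(i < n) 'X_i ^+ 2.
Definition meuler p := \sum_(i < n) 'X_i * p^`M(i).
(** The derivative along the infinitesimal rotation of the plane of the i-th and j-th
    coordinates. *)
Definition mangular (i j : 'I_n) p := 'X_i * p^`M(j) - 'X_j * p^`M(i).

Lemma dhomog_mderiv k i p : p \is k.-homog -> p^`M(i) \is k.-1.-homog.
Proof.
move=> /dhomogP hp; apply/dhomogP => m; rewrite mcoeff_msupp mcoeff_deriv.
case: (boolP (m + U_(i) \in msupp p)%MM) => [/hp /=|].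
  by rewrite mdegD mdeg1 addn1 => <-.
by rewrite mcoeff_msupp negbK => /eqP ->; rewrite mul0rn eqxx.
Qed.

(** As [k.-1] is truncated at 0, [dhomog_mderiv] does not say that constants have derivative
    zero. *)
Lemma dhomog0_mderiv i p : p \is 0.-homog -> p^`M(i) = 0.
Proof.
move=> /dhomogP hp; apply/mpolyP => m; rewrite mcoeff_deriv mcoeff0.
case: (boolP (m + U_(i) \in msupp p)%MM) => [/hp /=|].
  by rewrite mdegD mdeg1 addn1.
by rewrite mcoeff_msupp negbK => /eqP ->; rewrite mul0rn.
Qed.

Lemma meuler_homog k p : p \is k.-homog -> meuler p = k%:R *: p.
Proof.
move=> /dhomogP hp; rewrite {2}(mpolyE p) [p in meuler p]mpolyE /meuler.
under eq_bigr do rewrite raddf_sum mulr_sumr.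
rewrite exchange_big /= scaler_sumr; apply: eq_big_seq => m /hp /= mk.
under eq_bigr do rewrite mderivZ mderivX -scalerAr.
rewrite -scaler_sumr scalerA mulrC -scalerA; congr (_ *: _).
rewrite -mk mdegE natr_sum scaler_suml; apply: eq_bigr => i _.
rewrite -scalerAr -mpolyXD; case: (posnP (m i)) => [->|mi].
  by rewrite !scale0r.
by rewrite addmC submK // lep1mP -lt0n.
Qed.

Lemma mlaplacianD p q : mlaplacian (p + q) = mlaplacian p + mlaplacian q.
Proof. by rewrite -big_split; apply: eq_bigr => i _; rewrite !mderivD. Qed.

Lemma mlaplacianZ c p : mlaplacian (c *: p) = c *: mlaplacian p.
Proof. by rewrite scaler_sumr; apply: eq_bigr => i _; rewrite !mderivZ. Qed.

Lemma mlaplacian_homog k p : p \is k.-homog -> mlaplacian p \is k.-2.-homog.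
Proof.
by move=> hp; apply: rpred_sum => i _; exact/dhomog_mderiv/dhomog_mderiv.
Qed.

Lemma mlaplacian_homog_lt2 k p : (k < 2)%N -> p \is k.-homog -> mlaplacian p = 0.
Proof.
move=> k2 hp; apply: big1 => i _; apply: dhomog0_mderiv.
by have := dhomog_mderiv i hp; case: k k2 {hp} => [|[]].
Qed.

Lemma sqnorm_mpoly_homog : sqnorm_mpoly \is 2.-homog.
Proof.
apply: rpred_sum => i _; rewrite -[2%N]/(1 * 2)%N; apply: dhomogMn.
by rewrite dhomogX; apply/eqP; exact: mdeg1.
Qed.

Lemma mlaplacian_sqnormM q :
  mlaplacian (sqnorm_mpoly * q) =
  (2 * n%:R) *: q + 4 *: meuler q + sqnorm_mpoly * mlaplacian q.
Proof.
have drho i : sqnorm_mpoly^`M(i) = 2 *: 'X_i.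
  rewrite /sqnorm_mpoly raddf_sum (bigD1 i) //= big1 => [|j ji].
    by rewrite addr0 expr2 mderivM mderivXU eqxx mul1r mulr1 scaler_nat mulr2n.
  by rewrite expr2 mderivM mderivXU eq_sym (negbTE ji) mul0r mulr0 addr0.
have ddi i : (sqnorm_mpoly * q)^`M(i)^`M(i) =
    2 *: q + 4 *: ('X_i * q^`M(i)) + sqnorm_mpoly * q^`M(i)^`M(i).
  rewrite mderivM drho mderivD !mderivM mderivZ mderivXU eqxx drho.
  rewrite -!scalerAl mul1r.
  have -> : 4 = 2 + 2 :> R by ring.
  by rewrite (scalerDl _ 2 2) !addrA.
rewrite /mlaplacian; under eq_bigr do rewrite ddi.
rewrite !big_split /= -scaler_sumr -mulr_sumr sumr_const card_ord.
by rewrite -[_ *+ n]scaler_nat scalerA -[in LHS]scaler_sumr.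
Qed.

(** Each factor |x|^2 contributes 2 n plus 4 times a degree, so the constants add up without
    cancellation. Their positivity allows division by the constant of [iter_mlaplacian_sqnormX]. *)
Lemma mlaplacian_sqnormX j k h : h \is k.-homog -> mlaplacian h = 0 ->
  (0 < n)%N -> exists2 c : R, 0 < c &
  mlaplacian (sqnorm_mpoly ^+ j.+1 * h) = c *: (sqnorm_mpoly ^+ j * h).
Proof.
move=> hk h0 n0; elim: j => [|j [c c0 IHj]].
  exists (2 * n%:R + 4 * k%:R).
    by rewrite ltr_wpDr ?mulr_ge0 ?mulr_gt0 ?ltr0n.
  rewrite expr1 mlaplacian_sqnormM h0 mulr0 addr0 (meuler_homog hk) expr0 mul1r.
  by rewrite scalerA scalerDl.
have hom : sqnorm_mpoly ^+ j.+1 * h \is (2 * j.+1 + k).-homog.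
  by apply: dhomogM => //; apply: dhomogMn; exact: sqnorm_mpoly_homog.
exists (2 * n%:R + 4 * (2 * j.+1 + k)%:R + c).
  by rewrite addr_gt0 // ltr_wpDr ?mulr_ge0 ?mulr_gt0 ?ltr0n.
rewrite exprS -mulrA mlaplacian_sqnormM (meuler_homog hom) IHj.
by rewrite -scalerAr mulrA -exprS scalerA !scalerDl.
Qed.

Lemma iter_mlaplacian_sqnormX j k h : h \is k.-homog -> mlaplacian h = 0 ->
  (0 < n)%N -> exists2 c : R, 0 < c &
  iter j mlaplacian (sqnorm_mpoly ^+ j * h) = c *: h.
Proof.
move=> hk h0 n0; elim: j => [|j [c c0 IHj]].
  by exists 1; rewrite // mul1r scale1r.
have [b b0 lapj] := mlaplacian_sqnormX j hk h0 n0.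
exists (b * c); first by rewrite mulr_gt0.
have iterZ i a p : iter i mlaplacian (a *: p) = a *: iter i mlaplacian p.
  by elim: i => //= i ->; rewrite mlaplacianZ.
by rewrite iterSr lapj iterZ IHj scalerA.
Qed.

Lemma iter_mlaplacian_homog j k p : p \is k.-homog ->
  iter j mlaplacian p \is (k - j.*2).-homog /\
  ((k < j.*2)%N -> iter j mlaplacian p = 0).
Proof.
elim: j => [|j IHj] hp; first by rewrite subn0.
have [hom _] := IHj hp; split=> [|kj] /=.
  have := mlaplacian_homog hom; congr (_ \is _.-homog).
  by rewrite doubleS -addn2 subnDA subn2.
apply: mlaplacian_homog_lt2 hom; move: kj; rewrite doubleS => kj.
by lia.
Qed.

(** An induction principle that replaces the decomposition of a homogeneous polynomial into terms
    |x|^(2i) h_i with h_i harmonic. *)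
Lemma harmonic_span_ind (k : nat) (S : {mpoly R[n]} -> Prop) : (0 < n)%N ->
  (forall a p q, S p -> S q -> S (a *: p + q)) ->
  (forall p, S p -> S (sqnorm_mpoly * p)) ->
  (forall j h, (j <= k)%N -> h \is j.-homog -> mlaplacian h = 0 -> S h) ->
  forall j p, (j <= k)%N -> p \is j.-homog -> S p.
Proof.
move=> n0 SL Srho Sh j p jk pj.
(* Induction on the number of Laplacians that annihilate q. Since each lowers the degree by two,
   [j.+1] of them are enough. *)
suff gen m q : q \is j.-homog -> iter m mlaplacian q = 0 -> S q.
  by apply: (gen j.+1) => //; apply: (iter_mlaplacian_homog j.+1 pj).2; lia.
elim: m q => [|m IHm] q qj /= q0.
  apply: (Sh j); rewrite // q0 -(scale0r (0 : {mpoly R[n]})) mlaplacianZ.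
  by rewrite !scale0r.
have [hom small] := iter_mlaplacian_homog m qj.
case: (ltnP j m.*2) => [/small|mj]; first exact: IHm.
have Sm : S (sqnorm_mpoly ^+ m * iter m mlaplacian q).
  elim: (m in _ ^+ m) => [|i IHi]; last by rewrite exprS -mulrA; exact: Srho.
  by rewrite expr0 mul1r; apply: Sh hom q0; rewrite (leq_trans (leq_subr _ _)).
have [c c0 itc] := iter_mlaplacian_sqnormX m hom q0 n0.
set g := sqnorm_mpoly ^+ m * _ in Sm itc.
have iterL a (p1 p2 : {mpoly R[n]}) : iter m mlaplacian (a *: p1 + p2) =
    a *: iter m mlaplacian p1 + iter m mlaplacian p2.
  by elim: (m) => //= i ->; rewrite mlaplacianD mlaplacianZ.
(* The multiple of g is chosen so that the m-th iterated Laplacian of the second summand vanishes;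
   the induction hypothesis then applies to it. *)
have -> : q = c^-1 *: g + ((- c^-1) *: g + q).
  by rewrite addrA scaleNr subrr add0r.
apply: SL => //; apply: IHm.
  rewrite rpredD // dhomogZ // -(subnKC mj) -mul2n; apply: dhomogM; last by rewrite mul2n.
  exact/dhomogMn/sqnorm_mpoly_homog.
by rewrite iterL itc scaleNr scalerA mulVf ?gt_eqF // scale1r addNr.
Qed.

Lemma mangularD i j p q :
  mangular i j (p + q) = mangular i j p + mangular i j q.
Proof. by rewrite /mangular !mderivD; ring. Qed.

Lemma mangularM i j p q :
  mangular i j (p * q) = mangular i j p * q + p * mangular i j q.
Proof. by rewrite /mangular !mderivM; ring. Qed.

(** This is twice the Laplace-Beltrami operator, since every plane occurs as (i, j) and as (j, i),
    written through |x|^2 Delta and the Euler operator. *)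
Lemma sum_mangular2 p : \sum_i \sum_j mangular i j (mangular i j p) =
  2 *: (sqnorm_mpoly * mlaplacian p - meuler (meuler p)) -
  (2 * (n%:R - 2)) *: meuler p.
Proof.
(* The Kronecker symbol is made an opaque polynomial, so that [ring] can carry it along. *)
pose e (i j : 'I_n) : {mpoly R[n]} := (i == j)%:R.
have mangE i j : mangular i j (mangular i j p) =
    (e i j * ('X_i * p^`M(j)) + e i j * ('X_j * p^`M(i)))
    + ('X_i ^+ 2 * p^`M(j)^`M(j) + 'X_j ^+ 2 * p^`M(i)^`M(i))
    - ('X_i * p^`M(i) + 'X_j * p^`M(j))
    - 2 * ('X_i * 'X_j * p^`M(i)^`M(j)).
  rewrite /mangular !mderivB !mderivM !mderivXU !eqxx (eq_sym j i) -/(e i j).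
  by rewrite (mderiv_comm j i) !mul1r; ring.
have sum_e (F : 'I_n -> 'I_n -> {mpoly R[n]}) :
    \sum_i \sum_j e i j * F i j = \sum_i F i i.
  apply: eq_bigr => i _; rewrite (bigD1 i) //= /e eqxx mul1r big1 ?addr0 //.
  by move=> j /negbTE ji; rewrite eq_sym ji mul0r.
have sum2 : \sum_i \sum_j 2 * ('X_i * 'X_j * p^`M(i)^`M(j)) =
    2 * (meuler (meuler p) - meuler p).
  under eq_bigr do rewrite -mulr_sumr.
  rewrite -mulr_sumr; congr (2 * _).
  apply/eqP; rewrite eq_sym subr_eq; apply/eqP.
  rewrite {1}/meuler -big_split; apply: eq_bigr => i _ /=.
  rewrite /meuler raddf_sum mulr_sumr /=.
  under eq_bigr do rewrite mderivM mderivXU mulrDr.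
  rewrite big_split /= addrC; congr (_ + _).
    by apply: eq_bigr => j _; rewrite mderiv_comm mulrA.
  rewrite (bigD1 i) //= eqxx mul1r big1 ?addr0 //.
  by move=> j /negbTE ji; rewrite eq_sym ji mul0r mulr0.
under eq_bigr do under eq_bigr do rewrite mangE.
under eq_bigr do rewrite !(sumrB, big_split) /=.
rewrite !(sumrB, big_split) /= sum2 !sum_e.
rewrite [\sum_i \sum_j 'X_j ^+ 2 * _]exchange_big /=.
rewrite [\sum_i \sum_j 'X_j * p^`M(j)]exchange_big /=.
have -> : \sum_i \sum_j 'X_i ^+ 2 * p^`M(j)^`M(j) = sqnorm_mpoly * mlaplacian p.
  by rewrite mulr_suml; apply: eq_bigr => i _; rewrite mulr_sumr.
have -> : \sum_i \sum_(j < n) 'X_i * p^`M(i) = n%:R *: meuler p.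
  rewrite scaler_sumr; apply: eq_bigr => i _.
  by rewrite sumr_const card_ord scaler_nat.
rewrite -/(meuler p) -!mul_mpolyC !(mpolyCM, mpolyCB, mpolyC_nat).
by ring.
Qed.

Lemma sum_mangular2_harmonic k h : h \is k.-homog -> mlaplacian h = 0 ->
  \sum_i \sum_j mangular i j (mangular i j h) =
  (- (2 * (k%:R * (k%:R + n%:R - 2)))) *: h.
Proof.
move=> hk h0; rewrite sum_mangular2 h0 mulr0 (meuler_homog hk).
have -> : meuler (k%:R *: h) = k%:R *: (k%:R *: h).
  by apply: meuler_homog; rewrite dhomogZ.
rewrite -!mul_mpolyC !(mpolyCN, mpolyCM, mpolyCB, mpolyCD, mpolyC_nat).
by ring.
Qed.

(* The rotation by the angle 2 arctan u in the plane of the i-th and j-th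
   coordinates, multiplied by 1 + u^2 in order to be polynomial in u. *)
Definition plane_rot (i j : 'I_n) (u : R) (x : 'I_n -> R) (l : 'I_n) : R :=
  if l == i then (1 - u ^+ 2) * x i - 2 * u * x j
  else if l == j then (1 - u ^+ 2) * x j + 2 * u * x i
  else (1 + u ^+ 2) * x l.

(** Differentiation along the rotation becomes the extraction of a coefficient. The factor 2 is the
    derivative of the angle 2 arctan u at 0; the scaling by 1 + u^2 has no term of degree one and
    does not contribute. *)
Lemma meval_plane_rot (i j : 'I_n) p : i != j -> exists q : {poly {mpoly R[n]}},
  [/\ q`_0 = p, q`_1 = 2 * mangular i j p &
      forall u x, p.@[plane_rot i j u x] = q.[u%:MP].@[x]].
Proof.
move=> ij; elim/mpoly_ring_ind: p => [c|l|p1 p2|p1 p2].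
- exists (c%:MP)%:P; split=> [||u x]; rewrite ?coefC //=.
    by rewrite /mangular !mderivC; ring.
  by rewrite hornerC !mevalC.
- have ml : mangular i j 'X_l = 'X_i * (j == l)%:R - 'X_j * (i == l)%:R.
    by rewrite /mangular !mderivXU.
  exists (if l == i then Poly [:: 'X_i; - (2 * 'X_j); - 'X_i]
    else if l == j then Poly [:: 'X_j; 2 * 'X_i; - 'X_j]
    else Poly [:: 'X_l; 0; 'X_l]).
  rewrite ml (eq_sym j) (eq_sym i).
  pose mevalE_ := (mevalD, mevalM, mevalN, mevalXU, mevalC, meval0).
  have [->|li] := eqVneq l i; last have [->|lj] := eqVneq l j.
  + rewrite (negbTE ij) !coef_Poly; split=> [//|/=|u x]; first by ring.
    by rewrite horner_Poly /= !mevalE_ /plane_rot eqxx; ring.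
  + rewrite !coef_Poly; split=> [//|/=|u x]; first by ring.
    by rewrite horner_Poly /= !mevalE_ /plane_rot eq_sym (negbTE ij) eqxx; ring.
  + rewrite !coef_Poly; split=> [//|/=|u x]; first by ring.
    by rewrite horner_Poly /= !mevalE_ /plane_rot (negbTE li) (negbTE lj); ring.
- move=> [q1 [q10 q11 q1e]] [q2 [q20 q21 q2e]]; exists (q1 + q2).
  split=> [||u x]; rewrite ?coefD ?q10 ?q20 // ?q11 ?q21.
    by rewrite mangularD [RHS]mulrDr.
  by rewrite hornerD !mevalD q1e q2e.
- move=> [q1 [q10 q11 q1e]] [q2 [q20 q21 q2e]]; exists (q1 * q2).
  split=> [||u x].
  + by rewrite coefM big_ord1 /= q10 q20.
  + by rewrite coefM big_ord_recl big_ord1 /= q10 q20 q11 q21 mangularM; ring.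
  + by rewrite hornerM !mevalM q1e q2e.
Qed.

Lemma meval_homogZ k p c (x : 'I_n -> R) : p \is k.-homog ->
  p.@[fun i => c * x i] = c ^+ k * p.@[x].
Proof.
move=> /dhomogP hp; rewrite !mevalE mulr_sumr; apply: eq_big_seq => m /hp /= <-.
under eq_bigr do rewrite exprMn.
by rewrite big_split /= prodrXr -mdegE mulrCA.
Qed.

End PolynomialAlgebra.

Definition lin_closed (R : pzRingType) (V : lmodType R) (S : V -> Prop) : Prop :=
  S 0 /\ forall a v w, S v -> S w -> S (a *: v + w).

Section Degree.
Import mpoly.
Variables (R : numFieldType) (n : nat).
Implicit Types p q : {mpoly R[n]}.

Lemma lin_closed_msize k : lin_closed (fun p : {mpoly R[n]} => msize p <= k)%N.
Proof.
split=> [|a p q pk qk]; first by rewrite msize0.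
rewrite (leq_trans (msizeD_le _ _)) // geq_max qk andbT.
exact: leq_trans (msizeZ_le _ _) pk.
Qed.

Lemma msizeM_leq a b p q : (msize p <= a.+1)%N -> (msize q <= b.+1)%N ->
  (msize (p * q) <= (a + b).+1)%N.
Proof.
move=> pa qb; have [->|p0] := eqVneq p 0; first by rewrite mul0r msize0.
have [->|q0] := eqVneq q 0; first by rewrite mulr0 msize0.
rewrite msizeM //; have := leq_add pa qb.
by move: (msize p + msize q)%N => s; lia.
Qed.

Lemma msize_prod_leq (I : Type) (r : seq I) (P : pred I)
    (F : I -> {mpoly R[n]}) (k : I -> nat) :
  (forall i, P i -> msize (F i) <= (k i).+1)%N ->
  (msize (\prod_(i <- r | P i) F i) <= (\sum_(i <- r | P i) k i).+1)%N.
Proof.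
move=> Fk; elim/big_rec2: _ => [|i a p Pi pa]; first by rewrite msize1.
exact: msizeM_leq (Fk i Pi) pa.
Qed.

Lemma msizeX_leq a p m : (msize p <= a.+1)%N -> (msize (p ^+ m) <= (m * a).+1)%N.
Proof.
move=> pa; elim: m => [|m IHm]; first by rewrite expr0 msize1.
by rewrite exprS mulSn; exact: msizeM_leq.
Qed.

Lemma linear_substitution k (L : 'I_n -> {mpoly R[n]}) p :
  (forall i, msize (L i) <= 2)%N -> (msize p <= k.+1)%N ->
  exists2 q, (msize q <= k.+1)%N & forall v, q.@[v] = p.@[fun i => (L i).@[v]].
Proof.
move=> L2 pk; exists (p \mPo [tuple L i | i < n]); last first.
  by move=> v; rewrite comp_mpoly_meval; apply: meval_eq => i; rewrite tnth_mktuple.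
rewrite comp_mpolyE big_seq; have [S0 SL] := lin_closed_msize k.+1.
elim/big_ind: _ => [//|p1 p2 p1k p2k|m mp].
  by rewrite -[p1]scale1r; exact: SL.
rewrite -[_ *: _]addr0; apply: SL => //.
have mk : (mdeg m <= k)%N by rewrite -ltnS (leq_trans (msize_mdeg_lt mp)).
apply: (leq_trans (msize_prod_leq _ (k := fun i => m i) _)) => [i _|].
  by rewrite tnth_mktuple (leq_trans (msizeX_leq (m i) (L2 i))) ?muln1.
by rewrite -mdegE ltnS.
Qed.

End Degree.

(** * Monomials spanning the restrictions to the sphere *)

Section RestrictedMonomials.
Import mpoly.
Variables (R : numFieldType) (n k : nat).

(* Modulo |x|^2 - 1 the first variable is needed with exponent 0 or 1 only. *)
Definition restricted_mnm (t : bool * {ffun 'I_n -> 'I_k.+1}) : 'X_{1..n.+1} :=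
  [multinom if unlift ord0 i is Some j then t.2 j : nat else t.1 | i < n.+1].

Definition restricted_monomials : seq {mpoly R[n.+1]} :=
  [seq 'X_[m] | m <- map restricted_mnm (enum {: bool * {ffun 'I_n -> 'I_k.+1}})
              & (mdeg m <= k)%N].

(** The exponent is n although there are n + 1 variables, because the first exponent takes two
    values only. This is the source of the upper bound for the dimension. *)
Lemma size_restricted_monomials :
  (size restricted_monomials <= 2 * k.+1 ^ n)%N.
Proof.
rewrite size_map size_filter (leq_trans (count_size _ _)) // size_map -cardE.
by rewrite card_prod card_bool card_ffun !card_ord.
Qed.

Lemma msize_restricted_monomials p :
  p \in restricted_monomials -> (msize p <= k.+1)%N.
Proof.
by move=> /mapP [m]; rewrite mem_filter => /andP[mk _] ->; rewrite msizeX.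
Qed.

(** Replacing the square of the first variable by 1 minus the other squares lowers the first
    exponent by two and does not raise the degree. The statement is about an arbitrary S, so that it
    can be used with identities that hold only on the sphere. *)
Lemma restricted_monomials_span (S : {mpoly R[n.+1]} -> Prop) : lin_closed S ->
  (forall q, S ((sqnorm_mpoly R n.+1 - 1) * q)) ->
  {in restricted_monomials, forall p, S p} ->
  forall p, (msize p <= k.+1)%N -> S p.
Proof.
move=> [S0 SL] Srho Se p pk.
have SD q1 q2 : S q1 -> S q2 -> S (q1 + q2).
  by move=> S1 S2; rewrite -[q1]scale1r; exact: SL.
have SN q : S q -> S (- q).
  by move=> Sq; rewrite -[- q]addr0 -scaleN1r; exact: SL.
suff SX (m : 'X_{1..n.+1}) : (mdeg m <= k)%N -> S 'X_[m].
  rewrite (mpolyE p) big_seq; elim/big_ind: _ => // m mp.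
  rewrite -[_ *: _]addr0; apply: SL => //; apply: SX.
  by rewrite -ltnS (leq_trans (msize_mdeg_lt mp)).
move=> mk; have [N] := ubnP (m ord0).
elim: N m mk => // N IHN m mk; rewrite ltnS => mN.
have mle i : (m i <= k)%N.
  by rewrite (leq_trans _ mk) // mdegE (bigD1 i) //= leq_addr.
have [m1|m2] := leqP (m ord0) 1.
  apply: Se; apply: map_f; rewrite mem_filter mk /=; apply/mapP.
  exists (m ord0 == 1%N, [ffun j => inord (m (lift ord0 j))]).
    by rewrite mem_enum.
  apply/mnmP => i; rewrite mnmE; case: unliftP => [j|] -> /=.
    by rewrite ffunE inordK // ltnS.
  by case: (m ord0) m1 => [|[]].
pose m' := (m - U_(ord0) *+ 2)%MM.
have mE : m = (m' + U_(ord0) *+ 2)%MM.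
  rewrite /m' submK //; apply/mnm_lepP => i; rewrite mulmnE mnm1E.
  by case: eqVneq => [<-|_]; rewrite ?mul1n ?mul0n.
have m'0 : (m' ord0 < N)%N.
  apply: leq_trans mN; rewrite mE mnmDE mulmnE mnm1E eqxx mul1n; lia.
have m'k : (mdeg m' + 2 <= k)%N.
  by move: mk; rewrite {1}mE mdegD mdegMn mdeg1.
have -> : 'X_[m] = (sqnorm_mpoly R n.+1 - 1) * 'X_[m'] +
    ('X_[m'] - \sum_(i < n) 'X_[m' + U_(lift ord0 i) *+ 2]).
  rewrite /sqnorm_mpoly big_ord_recl /= mE mpolyXD -mpolyXn.
  under [X in _ = _ + (_ - X)]eq_bigr do rewrite mpolyXD -mpolyXn.
  by rewrite -mulr_sumr; ring.
apply: (SD); first exact: Srho.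
apply: (SD); first by apply: IHN => //; lia.
apply: SN; elim/big_ind: _ => // i _; apply: IHN.
  by rewrite mdegD mdegMn mdeg1.
by rewrite mnmDE mulmnE mnm1E (eq_sym (lift _ _)) (negbTE (neq_lift _ _)) addn0.
Qed.

End RestrictedMonomials.

Lemma quadratic_ge0_discr (R : realFieldType) (a c d : R) : 0 <= a ->
  (forall t, 0 <= a * t ^+ 2 + 2 * c * t + d) -> c ^+ 2 <= a * d.
Proof.
rewrite le_eqVlt => /predU1P[<- ge0|a0 /(_ (- (c / a)))].
  have [->|c0] := eqVneq c 0; first by rewrite expr0n mul0r.
  (* At this point the affine form 2 c t + d takes the value -1. *)
  have := ge0 (- (d + 1) / (2 * c)).
  have -> : 0 * (- (d + 1) / (2 * c)) ^+ 2 + 2 * c * (- (d + 1) / (2 * c)) + d = -1.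
    by field.
  by lra.
have -> : a * (- (c / a)) ^+ 2 + 2 * c * - (c / a) + d = d - c ^+ 2 / a.
  by field; rewrite gt_eqF.
by rewrite subr_ge0 ler_pdivrMr // mulrC.
Qed.

(** * Gram-Schmidt for a positive semidefinite form *)

Section GramSchmidt.
Variables (R : rcfType) (V : lmodType R) (b : V -> V -> R).
Hypothesis b_sym : forall v w, b v w = b w v.
Hypothesis b_lin : forall a u v w, b (a *: u + v) w = a * b u w + b v w.
Hypothesis b_ge0 : forall v, 0 <= b v v.

Lemma bform_cauchy_schwarz v w : b v w ^+ 2 <= b v v * b w w.
Proof.
apply: quadratic_ge0_discr => // t.
have := b_ge0 (t *: v + w).
rewrite b_lin 2![b _ (_ + _)]b_sym !b_lin (b_sym w v).
by congr (_ <= _); ring.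
Qed.

Lemma bform_triangle v w :
  Num.sqrt (b (v + w) (v + w)) <= Num.sqrt (b v v) + Num.sqrt (b w w).
Proof.
rewrite -(@ler_pXn2r _ 2) ?nnegrE ?addr_ge0 ?sqrtr_ge0 //.
rewrite sqrrD !sqr_sqrtr // -[v in b (v + _)]scale1r b_lin.
rewrite (b_sym v) (b_sym w) -[v in b (v + _)]scale1r !b_lin (b_sym w v).
have : b v w <= Num.sqrt (b v v) * Num.sqrt (b w w).
  rewrite -sqrtrM // (le_trans (ler_norm _)) // -sqrtr_sqr.
  by rewrite ler_wsqrtr // bform_cauchy_schwarz.
by rewrite -mulr_natr; lra.
Qed.

Lemma bform0l w : b 0 w = 0.
Proof. by have := b_lin (-1) 0 0 w; rewrite scaler0 addr0 mulN1r addNr. Qed.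

Lemma bform_null v : b v v = 0 -> forall w, b v w = 0.
Proof.
move=> v0 w; have := bform_cauchy_schwarz v w.
by rewrite v0 mul0r => bw; apply/eqP; rewrite -sqrf_eq0 eq_le bw sqr_ge0.
Qed.

Lemma bform_suml (I : Type) (r : seq I) (c : I -> R) (F : I -> V) w :
  b (\sum_(i <- r) c i *: F i) w = \sum_(i <- r) c i * b (F i) w.
Proof.
elim: r => [|i r IHr]; first by rewrite !big_nil bform0l.
by rewrite !big_cons b_lin IHr.
Qed.

(** The form may be degenerate, as polynomials that vanish on the sphere are null for all the forms
    of interest. So e is expanded in u under b only, not in V, and membership of u in the span of e
    is expressed through all predicates closed under linear combinations. *)
Lemma gram_schmidt (e : seq V) : exists u : seq V,
  [/\ (size u <= size e)%N, uniq u,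
      {in u &, forall v w, b v w = (v == w)%:R},
      forall S : V -> Prop, lin_closed S -> {in e, forall v, S v} ->
        {in u, forall v, S v}
    & {in e, forall v w, b v w = \sum_(z <- u) b v z * b z w}].
Proof.
elim: e => [|v e [u [su uu ou Su eu]]]; first by exists [::].
pose w := v - \sum_(z <- u) b v z *: z.
have bw z : b w z = b v z - \sum_(y <- u) b v y * b y z.
  rewrite /w -scaleN1r addrC b_lin mulN1r bform_suml addrC.
  by congr (_ - _); apply: eq_bigr.
have expand z c : z \in u -> \sum_(y <- u) c y * b y z = c z.
  move=> zu; rewrite (bigD1_seq z) //= ou // eqxx mulr1 big1_seq ?addr0 //.
  by move=> y /andP[/negbTE yz yu]; rewrite ou // yz mulr0.
have wu z : z \in u -> b w z = 0.
  by move=> zu; rewrite bw expand // subrr.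
have Sw S : lin_closed S -> {in v :: e, forall z, S z} -> S w.
  move=> cS Sve; have [S0 SL] := cS; rewrite /w addrC -scaleN1r; apply: (SL); last first.
    by apply: Sve; rewrite mem_head.
  have {}Su : {in u, forall z, S z}.
    by apply: Su => // z ze; apply: Sve; rewrite in_cons ze orbT.
  elim: (u) Su => [|z s IHs] Ss; first by rewrite big_nil.
  rewrite big_cons; apply: (SL); first by apply: Ss; rewrite mem_head.
  by apply: IHs => y ys; apply: Ss; rewrite in_cons ys orbT.
have Se S : {in v :: e, forall z, S z} -> {in e, forall z, S z}.
  by move=> Sve z ze; apply: Sve; rewrite in_cons ze orbT.
(* A remainder of norm zero is orthogonal to everything by Cauchy-Schwarz, so it is dropped. *)
have [w0|w0] := eqVneq (b w w) 0.
  exists u; split=> // [|S cS Sve|]; first exact: leqW.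
    by apply: Su => //; exact: Se.
  move=> z; rewrite in_cons => /predU1P[->|/eu //] y.
  by apply/eqP; rewrite -subr_eq0 -bw bform_null.
pose c := (Num.sqrt (b w w))^-1.
have ccw : c * c * b w w = 1.
  by rewrite -expr2 exprVn sqr_sqrtr // mulVf.
have bZ a x y : b (a *: x) y = a * b x y.
  by rewrite -[a *: x]addr0 b_lin bform0l addr0.
have bcu z : z \in u -> b (c *: w) z = 0 by move=> zu; rewrite bZ wu ?mulr0.
have bcc : b (c *: w) (c *: w) = 1 by rewrite bZ b_sym bZ mulrA.
have cwu : c *: w \notin u.
  apply/negP => /[dup] cu /bcu /eqP; rewrite bcc; exact/negP/oner_neq0.
exists (c *: w :: u); split=> /=.
- by rewrite ltnS.
- by rewrite cwu.
- move=> y z; rewrite !in_cons => /predU1P[->|yu] /predU1P[->|zu].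
  + by rewrite bcc eqxx.
  + by rewrite bcu //; case: eqVneq zu cwu => // <- ->.
  + by rewrite b_sym bcu //; case: eqVneq yu cwu => // -> ->.
  + exact: ou.
- move=> S cS Sve z; rewrite in_cons => /predU1P[->|].
    rewrite -[c *: w]addr0; apply: cS.2; [exact: Sw|exact: cS.1].
  by apply: Su => //; exact: Se.
- move=> z; rewrite in_cons => /predU1P[->|ze] y; rewrite big_cons.
    have -> : b v (c *: w) * b (c *: w) y = b w y.
      have -> : v = 1 *: w + \sum_(z <- u) b v z *: z by rewrite scale1r subrK.
      rewrite b_lin bform_suml big1_seq ?addr0 => [|x /andP[_ xu]].
        by rewrite mul1r b_sym !bZ mulrA -[RHS]mul1r -ccw; ring.
      by rewrite [b x _]b_sym bcu // mulr0.
    by rewrite bw subrK.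
  rewrite eu // b_sym bZ; suff -> : b w z = 0 by rewrite mulr0 mul0r add0r.
  rewrite b_sym eu // big1_seq // => x /andP[_ xu].
  by rewrite (b_sym x) wu // mulr0.
Qed.

End GramSchmidt.

(** * Reflection matrices *)

Section Reflections.
Variable (R : fieldType).

(** Sylvester's identity: the block matrix with rows (1, A) and (B, 1) is factored into triangular
    blocks in two ways. For a reflection it reduces the determinant to a 1 x 1 one. *)
Lemma det_sub_mulmx (m n : nat) (A : 'M[R]_(m, n)) (B : 'M[R]_(n, m)) :
  \det (1%:M - A *m B) = \det (1%:M - B *m A).
Proof.
have e1 : block_mx 1%:M A B 1%:M =
    block_mx 1%:M 0 B 1%:M *m block_mx 1%:M A 0 (1%:M - B *m A).
  rewrite mulmx_block !mul0mx !mul1mx ?mulmx1 ?mulmx0 ?addr0.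
  by rewrite addrC subrK.
have e2 : block_mx 1%:M A B 1%:M =
    block_mx 1%:M A 0 1%:M *m block_mx (1%:M - A *m B) 0 B 1%:M.
  by rewrite mulmx_block !mul0mx !mul1mx ?mulmx1 ?mulmx0 ?add0r subrK.
have := congr1 determinant e1; rewrite e2 !det_mulmx.
by rewrite !det_lblock !det_ublock !det1 !mul1r mulr1.
Qed.

Variable n : nat.
Definition reflection_mx (v : 'rV[R]_n) : 'M[R]_n := 1%:M - v^T *m (2 *: v).

Lemma mul_reflection_mx (v x : 'rV[R]_n) :
  x *m reflection_mx v = x - (2 * (x *m v^T) 0 0) *: v.
Proof.
rewrite mulmxBr mulmx1 mulmxA {1}[x *m v^T]mx11_scalar mul_scalar_mx.
by rewrite scalerA mulrC.
Qed.

Lemma reflection_mx_orthogonal (v : 'rV[R]_n) : v *m v^T = 1%:M ->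
  reflection_mx v *m (reflection_mx v)^T = 1%:M.
Proof.
move=> v1; pose P := v^T *m v.
have -> : reflection_mx v = 1%:M - 2 *: P by rewrite /reflection_mx -scalemxAr.
have PP : P *m P = P by rewrite /P -mulmxA [v *m (v^T *m v)]mulmxA v1 mul1mx.
have PT : P^T = P by rewrite /P trmx_mul trmxK.
have -> : (1%:M - 2 *: P)^T = 1%:M - 2 *: P.
  apply/matrixP => i j; move: P PP PT => P _ PT.
  by rewrite !mxE eq_sym -{1}PT mxE.
rewrite mulmxBl mul1mx mulmxBr mulmx1 -scalemxAl -scalemxAr PP.
apply/matrixP => i j; move: P {PP PT} => P.
by rewrite !mxE; ring.
Qed.

Lemma det_reflection_mx (v : 'rV[R]_n) : v *m v^T = 1%:M ->
  \det (reflection_mx v) = -1.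
Proof.
move=> v1; rewrite det_sub_mulmx -scalemxAl v1 det_mx11 !mxE /=.
by ring.
Qed.

End Reflections.

(* Not imported before, as its notations clash with those of mpoly used above. *)
From mathcomp Require Import all_classical all_reals all_analysis measurable_realfun.

Import Order.TTheory GRing.Theory Num.Theory.
Import numFieldNormedType.Exports.
Import (canonicals, coercions) mpoly.

Local Open Scope classical_set_scope.
Local Open Scope ring_scope.

(** * Topology and rotations of the sphere *)

Section SphereTopology.
Variables (R : realType) (d : nat).
Local Notation S := (sphere R d).

Definition dot (x y : 'rV[R]_d.+1) : R := (x *m y^T) 0 0.

Lemma dotE x y : dot x y = \sum_i x 0 i * y 0 i.
Proof. by rewrite /dot mxE; apply: eq_bigr => i _; rewrite mxE. Qed.

Lemma dotC x y : dot x y = dot y x.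
Proof. by rewrite !dotE; apply: eq_bigr => i _; rewrite mulrC. Qed.

Lemma dotZDl a x y z : dot (a *: x + y) z = a * dot x z + dot y z.
Proof.
rewrite !dotE mulr_sumr -big_split /=; apply: eq_bigr => i _.
by rewrite !mxE; ring.
Qed.

Lemma dot_sqrB x y : dot (x - y) (x - y) = dot x x - 2 * dot x y + dot y y.
Proof.
rewrite !dotE mulr_sumr -sumrB -big_split /=; apply: eq_bigr => i _.
by rewrite !mxE; ring.
Qed.

Lemma dot_ge0 x : 0 <= dot x x.
Proof. by rewrite dotE; apply: sumr_ge0 => i _; rewrite -expr2 sqr_ge0. Qed.

Lemma dot_eq0 x : dot x x = 0 -> x = 0.
Proof.
rewrite dotE => /eqP; rewrite psumr_eq0 => [/allP x0|i _]; last first.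
  by rewrite -expr2 sqr_ge0.
apply/rowP => i; rewrite mxE; apply/eqP.
by have := x0 i (mem_index_enum i); rewrite -expr2 sqrf_eq0.
Qed.

Lemma dot_sphere (x : S) : dot (sphere_val x) (sphere_val x) = 1.
Proof.
case: x => x hx; rewrite /sphere_val /= dotE -(eqP hx).
by apply: eq_bigr => i _; rewrite expr2.
Qed.

Lemma dot_sphere_bounds (x y : S) :
  -1 <= dot (sphere_val x) (sphere_val y) <= 1.
Proof.
have := dot_ge0 (sphere_val x - sphere_val y).
have := dot_ge0 (1 *: sphere_val x + sphere_val y).
rewrite dot_sqrB dotZDl !(dotC _ (_ + _)) !dotZDl.
rewrite (dotC (sphere_val y) (sphere_val x)) !dot_sphere => *.
by apply/andP; split; lra.
Qed.

Lemma sphere_val_inj : injective (@sphere_val R d).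
Proof. exact: val_inj. Qed.

Lemma sphere_of_dot (x : 'rV[R]_d.+1) : dot x x = 1 ->
  exists y : S, sphere_val y = x.
Proof.
move=> x1; have hx : \sum_(i < d.+1) x 0 i ^+ 2 == 1.
  by rewrite -x1 dotE; apply/eqP/eq_bigr => i _; rewrite expr2.
by exists (exist _ x hx).
Qed.

Lemma sphere_val_continuous : continuous (@sphere_val R d).
Proof. exact: initial_continuous. Qed.

Lemma sphere_coord_continuous i : continuous (fun x : S => sphere_val x 0 i).
Proof.
move=> x; apply: (@continuous_comp S 'rV[R]_d.+1 R (@sphere_val R d)
  (fun M => M 0 i)); first exact: sphere_val_continuous.
exact: coord_continuous.
Qed.

Lemma sphere_continuousD (f g : S -> R) : continuous f -> continuous g ->
  continuous (fun x => f x + g x).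
Proof.
move=> cf cg x; apply: cvgD; [exact: (@nbhs_filter S x)|exact: cf|exact: cg].
Qed.

Lemma sphere_continuousM (f g : S -> R) : continuous f -> continuous g ->
  continuous (fun x => f x * g x).
Proof.
move=> cf cg x; apply: cvgM; [exact: (@nbhs_filter S x)|exact: cf|exact: cg].
Qed.

Lemma sphere_eval_continuous (p : mpoly.mpoly d.+1 R) :
  continuous (sphere_eval p : S -> R).
Proof.
elim/mpoly_ring_ind: p => [c|i|p q cp cq|p q cp cq] x.
- rewrite (_ : sphere_eval _ = cst c); first exact: cst_continuous.
  by apply/funext => y; rewrite /sphere_eval mpoly.mevalC.
- rewrite (_ : sphere_eval _ = fun x : S => sphere_val x 0 i).
    exact: sphere_coord_continuous.
  by apply/funext => y; rewrite /sphere_eval mpoly.mevalXU.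
- rewrite (_ : sphere_eval _ = sphere_eval p \+ sphere_eval q).
    by apply: continuousD; [exact: cp|exact: cq].
  by apply/funext => y; rewrite /sphere_eval mpoly.mevalD.
- rewrite (_ : sphere_eval _ = sphere_eval p \* sphere_eval q).
    by apply: continuousM; [exact: cp|exact: cq].
  by apply/funext => y; rewrite /sphere_eval mpoly.mevalM.
Qed.

Lemma sphere_compact : compact [set: S].
Proof.
have cK : compact (range (@sphere_val R d)).
  apply: bounded_closed_compact.
    exists 1; split=> // M M1 _ [x _ <-]; change (mx_norm (sphere_val x) <= M); rewrite mx_normrE.
    apply/bigmax_leP; split=> [|[i j] _ /=]; first by rewrite ltW ?(lt_trans _ M1).
    rewrite (ord1 i); apply: le_trans (ltW M1).
    rewrite -(@expr_le1 _ 2) // real_normK ?num_real // -(dot_sphere x) dotE.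
    rewrite (bigD1 j) //= -expr2 lerDl; apply: sumr_ge0 => k _.
    by rewrite -expr2 sqr_ge0.
  have -> : range (@sphere_val R d) =
      [set x : 'rV[R]_d.+1 | \sum_i x 0 i ^+ 2 = 1].
    apply/seteqP; split=> [_ [x _ <-]|x /eqP hx] /=.
      by rewrite -(dot_sphere x) dotE; apply: eq_bigr => i _; rewrite expr2.
    by exists (exist _ x hx).
  apply: (@preimage_closed _ _ (fun x : 'rV[R]_d.+1 => \sum_i x 0 i ^+ 2)
    [set 1]); last exact: closed_eq.
  move=> x _.
  apply: (@continuous_big R _ +%R 0 xpredT) => [|i _ y].
    exact: add_continuous.
  apply: (@continuous_comp _ _ _ (fun M : 'rV[R]_d.+1 => M 0 i)
    (fun t => t ^+ 2)); first exact: coord_continuous.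
  exact: exprn_continuous.
(* The topology of the sphere is induced by [sphere_val], so a cluster point of the image filter in
   the compact image comes from a cluster point on the sphere. *)
move=> F FF _; have [|_ [[x _ <-] xF]] := cK (sphere_val @ F) _.
  by apply: (@filterE S F) => x; exists x.
exists x; split=> // A B FA; rewrite nbhsE => -[_ [[V oV <-] Vx] VB].
have FvA : (sphere_val @ F) (sphere_val @` A).
  by apply: (@filterS S F) FA => a Aa; exists a.
have [_ [[a Aa <-] Va]] := xF _ V FvA (open_nbhs_nbhs (conj oV Vx)).
by exists a; split=> //; exact: VB.
Qed.

Lemma sphere_continuous_bounded (f : S -> R) : continuous f ->
  exists2 M, 0 <= M & forall x, `|f x| <= M.
Proof.
move=> cf; have cn : {within [set: S], continuous (fun x => `|f x|)}.
  apply: continuous_subspaceT => x.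
  by apply: (@continuous_comp _ _ _ f Num.norm); [exact: cf|exact: norm_continuous].
have [|c _ fc] := compact_EVT_max _ sphere_compact cn; first by exists point.
by exists `|f c| => // x; apply: fc; rewrite inE.
Qed.

Lemma sphere_open_measurable (A : set S) : open A -> measurable A.
Proof. by move=> oA; exact: sub_sigma_algebra. Qed.

Lemma sphere_continuous_measurable (f : S -> R) : continuous f ->
  measurable_fun setT f.
Proof.
move=> /continuousP cf; apply: (measurability _ (RGenOpens.measurableE R)).
move=> _ [_ [a [b ->] <-]]; rewrite setTI; apply: sphere_open_measurable.
exact/cf/interval_open.
Qed.

Definition rotation (U : 'M[R]_d.+1) : Prop := U *m U^T = 1%:M /\ \det U = 1.

Lemma dot_orthogonal (U : 'M[R]_d.+1) x y : U *m U^T = 1%:M ->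
  dot (x *m U) (y *m U) = dot x y.
Proof. by move=> UU; rewrite /dot trmx_mul mulmxA -(mulmxA x) UU mulmx1. Qed.

(** Total in U: where [x *m U] is not on the sphere the default value is x. By [rotateE] this never
    happens for a rotation. *)
Definition rotate (U : 'M[R]_d.+1) (x : S) : S :=
  insubd x (sphere_val x *m U).

Lemma rotateE U x : rotation U -> sphere_val (rotate U x) = sphere_val x *m U.
Proof.
move=> [UU _]; rewrite /rotate /sphere_val -/(sphere_val x).
rewrite [LHS](@insubdK _ _ S) //; have := dot_orthogonal (sphere_val x) (sphere_val x) UU.
rewrite dot_sphere dotE => e; rewrite unfold_in /= -e.
by apply/eqP/eq_bigr => i _; rewrite expr2.
Qed.

Lemma rotate_continuous U : rotation U -> continuous (rotate U).
Proof.
move=> rU; apply: (@continuous_comp_initial _ S 'rV[R]_d.+1 (@sphere_val R d)).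
rewrite (_ : _ \o _ = fun x : S => sphere_val x *m U); last first.
  by apply/funext => x; exact: rotateE.
rewrite (_ : (fun _ => _) =
    fun x : S => \sum_i sphere_val x 0 i *: row i U); last first.
  by apply/funext => x; rewrite mulmx_sum_row.
apply: (@continuous_big 'rV[R]_d.+1 _ +%R 0 xpredT) => [|i _ y].
  exact: add_continuous.
apply: cvgZr_tmp; [exact: (@nbhs_filter S y)|exact: sphere_coord_continuous].
Qed.

Lemma unit_row_mulmx (v : 'rV[R]_d.+1) : dot v v = 1 -> v *m v^T = 1%:M.
Proof. by move=> v1; rewrite [LHS]mx11_scalar -[X in X%:M]/(dot v v) v1. Qed.

Lemma rotation_reflections (v w : 'rV[R]_d.+1) : dot v v = 1 -> dot w w = 1 ->
  rotation (reflection_mx v *m reflection_mx w).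
Proof.
move=> /unit_row_mulmx v1 /unit_row_mulmx w1; split; last first.
  by rewrite det_mulmx !det_reflection_mx // mulrNN mulr1.
rewrite trmx_mul mulmxA -(mulmxA (reflection_mx v)).
by rewrite !(reflection_mx_orthogonal, mulmx1).
Qed.

Lemma mul_reflection (v x : 'rV[R]_d.+1) :
  x *m reflection_mx v = x - (2 * dot x v) *: v.
Proof. exact: mul_reflection_mx. Qed.

Lemma unit_row_orthogonal (v : 'rV[R]_d.+1) : (0 < d)%N ->
  exists2 w : 'rV[R]_d.+1, dot w w = 1 & dot v w = 0.
Proof.
move=> d0; pose w := nz_row (kermx v^T).
have wv : w *m v^T = 0 by apply/sub_kermxP; exact: nz_row_sub.
have w0 : w != 0.
  rewrite nz_row_eq0 -mxrank_eq0 mxrank_ker mxrank_tr -lt0n subn_gt0.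
  by rewrite (leq_ltn_trans (rank_leq_row v)).
have ww : 0 < dot w w.
  by rewrite lt_def dot_ge0 andbT; apply: contra_neq w0; exact: dot_eq0.
pose c := (Num.sqrt (dot w w))^-1.
have dotZ a x y : dot (a *: x) y = a * dot x y.
  by rewrite -[a *: x]addr0 dotZDl /dot mul0mx [X in _ + X]mxE addr0.
exists (c *: w); last by rewrite dotC dotZ /dot wv mxE mulr0.
rewrite dotZ dotC dotZ mulrA -expr2 exprVn sqr_sqrtr ?ltW // mulVf //.
by rewrite gt_eqF.
Qed.

(** The reflection along x - y sends x to y. A second reflection, along a unit vector orthogonal to
    y, fixes y and brings the determinant back to 1; such a vector exists as d is positive. *)
Lemma rotation_transitive (x y : S) : (0 < d)%N ->
  exists2 U, rotation U & rotate U x = y.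
Proof.
move=> d0; have [xy|xy] := eqVneq x y.
  have r1 : rotation 1%:M by split; rewrite ?trmx1 ?mulmx1 ?det1.
  by exists 1%:M => //; apply: sphere_val_inj; rewrite rotateE // mulmx1 xy.
set u := sphere_val x; set v := sphere_val y.
have uu : dot u u = 1 := dot_sphere x; have vv : dot v v = 1 := dot_sphere y.
pose w := u - v.
have w0 : dot w w != 0.
  apply: contra_neq xy => /dot_eq0 /eqP; rewrite subr_eq0 => /eqP.
  exact: sphere_val_inj.
have dotwl z : dot w z = dot u z - dot v z.
  by rewrite /w addrC -scaleN1r dotZDl; ring.
have ww : dot w w = 2 * dot u w.
  by rewrite dotwl (dotC v) (dotC u) !dotwl uu vv (dotC v); ring.
have dotZ a z1 z2 : dot (a *: z1) z2 = a * dot z1 z2.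
  by rewrite -[a *: z1]addr0 dotZDl /dot mul0mx [X in _ + X]mxE addr0.
pose c := (Num.sqrt (dot w w))^-1.
have cc : c * c * dot w w = 1.
  by rewrite -expr2 exprVn sqr_sqrtr ?dot_ge0 // mulVf.
have [b bb vb] := unit_row_orthogonal v d0.
have a1 : dot (c *: w) (c *: w) = 1 by rewrite dotZ dotC dotZ mulrA.
have rU := rotation_reflections a1 bb.
exists (reflection_mx (c *: w) *m reflection_mx b) => //.
apply: sphere_val_inj; rewrite rotateE // -/u -/v mulmxA !mul_reflection.
have -> : u - (2 * dot u (c *: w)) *: (c *: w) = v.
  rewrite dotC dotZ scalerA dotC.
  have -> : 2 * (c * dot u w) * c = 1 by rewrite -[RHS]cc ww; ring.
  by rewrite scale1r /w opprB addrC subrK.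
by rewrite vb mulr0 scale0r subr0.
Qed.

End SphereTopology.

(** * Integration on the sphere *)

Section L2Product.
Variables (R : realType) (d : nat) (sigma : probability (sphere R d) R).
Local Notation S := (sphere R d).
Local Notation L2 := (Lfun sigma 2%:E).

Definition l2prod (f g : S -> R) : R := \int[sigma]_x (f x * g x).

Lemma continuous_L2 (f : S -> R) : continuous f -> f \in L2.
Proof.
move=> cf; have mf := sphere_continuous_measurable cf.
have [M M0 fM] := sphere_continuous_bounded cf.
rewrite inE; apply/andP; split; rewrite inE //=.
rewrite /finite_norm unlock /= poweR_lty //.
apply: (@le_lt_trans _ _ (\int[sigma]_x (M `^ 2)%:E)%E).
  apply: ge0_le_integral => //.
  - apply/measurable_EFinP; apply: (measurableT_comp (measurable_powR _)) => //.
    exact: measurableT_comp.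
  - by move=> x _; rewrite lee_fin ge0_ler_powR // nnegrE.
by rewrite integral_cst //= probability_setT mule1 ltry.
Qed.

Lemma L2_lin a (f g : S -> R) : f \in L2 -> g \in L2 ->
  (fun x => a * f x + g x) \in L2.
Proof.
have p1 : (1 <= 2%:E :> \bar R)%E by rewrite lee_fin ler1n.
by move=> Lf Lg; have [_ /(_ a f g Lf Lg)] := Lfun_submod_closed sigma p1.
Qed.

Lemma L2_mul_integrable (f g : S -> R) : f \in L2 -> g \in L2 ->
  sigma.-integrable setT (EFin \o (fun x => f x * g x)).
Proof. by move=> Lf Lg; apply/Lfun1_integrable/Lfun2_mul_Lfun1. Qed.

Lemma l2prodC f g : l2prod f g = l2prod g f.
Proof. by rewrite /l2prod; under eq_Rintegral do rewrite mulrC. Qed.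

Lemma l2prod_lin a f g h : f \in L2 -> g \in L2 -> h \in L2 ->
  l2prod (fun x => a * f x + g x) h = a * l2prod f h + l2prod g h.
Proof.
move=> Lf Lg Lh; rewrite /l2prod.
have ifh := L2_mul_integrable Lf Lh; have igh := L2_mul_integrable Lg Lh.
under eq_Rintegral do rewrite mulrDl -mulrA.
rewrite RintegralD //; first by rewrite RintegralZl.
by have := integrableZl measurableT a ifh; apply: eq_integrable.
Qed.

Lemma l2prod_ge0 f : 0 <= l2prod f f.
Proof. by apply: Rintegral_ge0 => x _; rewrite -expr2 sqr_ge0. Qed.

Lemma L2_sum (I : Type) (s : seq I) (c : I -> R) (F : I -> S -> R) :
  (forall i, F i \in L2) -> (fun x => \sum_(i <- s) c i * F i x) \in L2.
Proof.
move=> LF; elim: s => [|i s IHs].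
  rewrite (_ : (fun _ => _) = cst 0); first by apply: Lfun_cst.
  by apply/funext => x; rewrite big_nil.
rewrite (_ : (fun _ => _) = fun x => c i * F i x + \sum_(j <- s) c j * F j x).
  exact: L2_lin.
by apply/funext => x; rewrite big_cons.
Qed.

Lemma l2prod_sum (I : Type) (s : seq I) (c : I -> R) (F : I -> S -> R) h :
  (forall i, F i \in L2) -> h \in L2 ->
  l2prod (fun x => \sum_(i <- s) c i * F i x) h =
  \sum_(i <- s) c i * l2prod (F i) h.
Proof.
move=> LF Lh; elim: s => [|i s IHs].
  rewrite big_nil /l2prod; under eq_Rintegral do rewrite big_nil mul0r.
  by rewrite Rintegral_cst // mul0r.
rewrite big_cons -IHs -l2prod_lin //; last exact: L2_sum.
by congr l2prod; apply/funext => x; rewrite big_cons.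
Qed.

Lemma l2prod_cauchy_schwarz f g : f \in L2 -> g \in L2 ->
  l2prod f g ^+ 2 <= l2prod f f * l2prod g g.
Proof.
move=> Lf Lg; apply: quadratic_ge0_discr => [|t]; first exact: l2prod_ge0.
have := l2prod_ge0 (fun x => t * f x + g x).
have Lh := L2_lin t Lf Lg.
rewrite l2prod_lin // (l2prodC f) (l2prodC g) !l2prod_lin //.
by rewrite (l2prodC g f); congr (_ <= _); ring.
Qed.

Definition l2nrm f : R := Num.sqrt (l2prod f f).

Lemma l2norm_l2nrm f : f \in L2 -> l2norm sigma f = (l2nrm f)%:E.
Proof.
move=> Lf; have iff := L2_mul_integrable Lf Lf.
rewrite /l2norm /l2nrm unlock.
have -> : (\int[sigma]_x (`|(EFin \o f) x| `^ 2) = (l2prod f f)%:E)%E.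
  rewrite /l2prod /Rintegral fineK; last exact: integrable_fin_num.
  apply: eq_integral => x _ /=.
  by rewrite powR_mulrn // -normrX ger0_norm ?sqr_ge0.
by rewrite poweR_EFin -powR12_sqrt ?l2prod_ge0.
Qed.

Lemma l2prod_le f g : f \in L2 -> g \in L2 ->
  `|l2prod f g| <= l2nrm f * l2nrm g.
Proof.
move=> Lf Lg; rewrite -sqrtrM ?l2prod_ge0 // -sqrtr_sqr.
by apply: ler_wsqrtr; exact: l2prod_cauchy_schwarz.
Qed.

Lemma l2nrmD f g : f \in L2 -> g \in L2 ->
  l2nrm (fun x => f x + g x) <= l2nrm f + l2nrm g.
Proof.
move=> Lf Lg; rewrite -(@ler_pXn2r _ 2) ?nnegrE ?addr_ge0 ?sqrtr_ge0 //.
rewrite sqrrD !sqr_sqrtr ?l2prod_ge0 //.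
have -> : (fun x => f x + g x) = (fun x => 1 * f x + g x).
  by apply/funext => x; rewrite mul1r.
have Lh := L2_lin 1 Lf Lg.
rewrite l2prod_lin // (l2prodC f) (l2prodC g) !l2prod_lin //.
have := le_trans (ler_norm _) (l2prod_le Lf Lg); rewrite (l2prodC g f).
by rewrite /l2nrm -mulr_natr; lra.
Qed.

Lemma Rintegral_le_l2nrm f : f \in L2 -> `|\int[sigma]_x f x| <= l2nrm f.
Proof.
move=> Lf; have L1 : cst 1 \in L2 by exact: Lfun_cst.
have := l2prod_le Lf L1.
rewrite /l2nrm /l2prod /=; under eq_Rintegral do rewrite mulr1.
under [X in _ * Num.sqrt X]eq_Rintegral do rewrite mulr1.
rewrite Rintegral_cst // mul1r.
have -> : fine (sigma setT) = 1 by rewrite probability_setT.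
by rewrite sqrtr1 mulr1.
Qed.

Hypothesis sigma_inv : rotation_invariant sigma.

Lemma measure_rotate U (A : set S) : rotation U -> measurable A ->
  sigma (rotate U @^-1` A) = sigma A.
Proof.
move=> rU mA; rewrite -(sigma_inv rU.1 rU.2 mA); congr (sigma _).
apply/seteqP; split=> [x Ax|x [y Ay yx]] /=.
  by exists (rotate U x) => //; rewrite rotateE.
by rewrite (_ : rotate U x = y) //; apply: sphere_val_inj; rewrite rotateE.
Qed.

Lemma rotate_measurable U : rotation U -> measurable_fun setT (@rotate R d U).
Proof.
move=> rU; apply: (@measurability _ _ _ _ setT (rotate U) _ erefl).
move=> _ [B oB <-]; rewrite setTI; apply: sphere_open_measurable.
by have /continuousP := rotate_continuous rU; exact.
Qed.

Lemma Rintegral_rotate U (f : S -> R) : rotation U -> continuous f ->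
  \int[sigma]_x f (rotate U x) = \int[sigma]_x f x.
Proof.
move=> rU cf; have mr := rotate_measurable rU.
have cfr : continuous (f \o rotate U).
  by move=> x; apply: continuous_comp; [exact: rotate_continuous|exact: cf].
have L1 g : continuous g -> sigma.-integrable setT (EFin \o g).
  move=> cg; apply/Lfun1_integrable; apply: Lfun_subset12; last exact: continuous_L2.
  exact: fin_num_measure.
have := @integral_pushforward _ _ _ _ R (rotate U) mr sigma setT (EFin \o f).
move=> /(_ _ _ measurableT); rewrite preimage_setT => eqf.
rewrite /Rintegral -eqf.
- congr fine; apply: eq_measure_integral => A mA _.
  by rewrite /pushforward -[RHS](measure_rotate rU).
- by apply/measurable_EFinP; exact: sphere_continuous_measurable.
- exact: L1 cfr.
Qed.

Hypothesis d_gt0 : (0 < d)%N.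

(** By transitivity the rotated copies of A cover the sphere, and by compactness finitely many do.
    Were A null, the whole sphere would be. *)
Lemma sphere_open_measure_gt0 (A : set S) x : open A -> A x -> (0 < sigma A)%E.
Proof.
move=> oA Ax; rewrite lt0e measure_ge0 andbT; apply/eqP => A0.
have cover : [set: S] `<=` cover (@rotation R d) (fun U => rotate U @^-1` A).
  by move=> y _; have [U rU Uy] := rotation_transitive y x d_gt0; exists U => //=; rewrite Uy.
have oU U : rotation U -> open (rotate U @^-1` A).
  by move=> rU; have /continuousP := rotate_continuous rU; exact.
have := @sphere_compact R d; rewrite compact_cover => /(_ _ _ _ oU cover) [D DR Dc].
have r1 : rotation (1%:M : 'M[R]_d.+1) by split; rewrite ?trmx1 ?mulmx1 ?det1.
(* The finite cover is indexed by all natural numbers to form a countable union. Past its end the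
   default is the identity, again a rotation, so that every [F k] is null. *)
pose F k := rotate (nth 1%:M (finmap.enum_fset D) k) @^-1` A.
have rF k : rotation (nth 1%:M (finmap.enum_fset D) k).
  have [kD|kD] := ltnP k (size (finmap.enum_fset D)); last by rewrite nth_default.
  by apply: set_mem; apply: DR; exact: mem_nth.
have nF k : sigma.-negligible (F k).
  have mF : measurable (F k) by apply: sphere_open_measurable; apply: oU.
  exists (F k); split=> //; rewrite /F measure_rotate //.
  exact: sphere_open_measurable.
have : sigma.-negligible [set: S].
  apply: negligibleS (negligible_bigcup nF) => y _.
  have [U UD Uy] := Dc y I; exists (index U (finmap.enum_fset D)) => //.
  by rewrite /F nth_index.
move=> [B [mB B0 TB]]; have := probability_setT sigma.
have -> : [set: S] = B by apply/seteqP; split.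
rewrite B0 => /eqP.
by rewrite eq_sym onee_eq0.
Qed.

Lemma continuous_integrable (g : S -> R) : continuous g ->
  sigma.-integrable setT (EFin \o g).
Proof.
move=> cg; apply/Lfun1_integrable; apply: Lfun_subset12.
  exact: fin_num_measure.
exact: continuous_L2.
Qed.

Lemma Rintegral_lower_bound (g : S -> R) (A : set S) c : continuous g ->
  (forall x, 0 <= g x) -> open A -> 0 <= c -> (forall x, A x -> c <= g x) ->
  c * fine (sigma A) <= \int[sigma]_x g x.
Proof.
move=> cg g0 oA c0 cgA; have mA := sphere_open_measurable oA.
have mg : measurable_fun setT (EFin \o g).
  by apply/measurable_EFinP; exact: sphere_continuous_measurable.
rewrite -lee_fin EFinM fineK ?fin_num_measure // /Rintegral fineK; last first.
  exact/integrable_fin_num/continuous_integrable.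
rewrite -integral_cst //.
apply: (@le_trans _ _ (\int[sigma]_(x in A) (g x)%:E)%E).
  by apply: ge0_le_integral => //; apply: measurable_funS mg.
by apply: ge0_subset_integral => // x _; rewrite lee_fin.
Qed.

Lemma Rintegral_eq0 (g : S -> R) : continuous g -> (forall x, 0 <= g x) ->
  \int[sigma]_x g x = 0 -> forall x, g x = 0.
Proof.
move=> cg g0 ig x; apply/eqP; rewrite eq_le g0 andbT leNgt; apply/negP => gx.
pose A := g @^-1` [set t | g x / 2 < t].
have oA : open A by have /continuousP := cg; apply; exact: open_gt.
have Ax : A x by rewrite /A /= ltr_pdivrMr // ltr_pMr // ltr1n.
have := Rintegral_lower_bound cg g0 oA (ltW (divr_gt0 gx (ltr0n _ 2))) (fun y => @ltW _ _ _ _).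
rewrite ig leNgt mulr_gt0 ?divr_gt0 //.
rewrite fine_gt0 // (sphere_open_measure_gt0 oA Ax) ltey_eq fin_num_measure //.
exact: sphere_open_measurable.
Qed.

Lemma sphere_nbhs_cap (x : S) (A : set S) : nbhs x A -> exists2 e, 0 < e &
  forall y, 1 - e < dot (sphere_val x) (sphere_val y) -> A y.
Proof.
rewrite nbhsE => -[_ [[V oV <-] Vx] VA].
have /nbhs_ballP [e /= e0 eV] := open_nbhs_nbhs (conj oV Vx).
(* On the sphere |x - y|^2 = 2 - 2 x.y, and the balls are those of the sup norm, which is below the
   Euclidean norm. *)
exists (e ^+ 2 / 2); first by rewrite divr_gt0 ?exprn_gt0.
move=> y xy; apply/VA/eV; split=> // i j; rewrite (ord1 i) -ball_normE /=.
rewrite -(@ltr_pXn2r _ 2) ?nnegrE ?(ltW e0) // real_normK ?num_real //.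
have dd : dot (sphere_val x - sphere_val y) (sphere_val x - sphere_val y) < e ^+ 2.
  by rewrite dot_sqrB !dot_sphere; lra.
apply: le_lt_trans dd; rewrite dotE (bigD1 j) //= !mxE -expr2 lerDl.
by apply: sumr_ge0 => k _; rewrite -expr2 sqr_ge0.
Qed.

Lemma bernoulli_le (a : R) m : 0 <= a -> 1 + m%:R * a <= (1 + a) ^+ m.
Proof.
move=> a0; elim: m => [|m IHm]; first by rewrite mul0r addr0 expr0.
rewrite exprS (le_trans _ (ler_wpM2l _ IHm)) ?addr_ge0 //.
by rewrite -natr1; have := mulr_ge0 (ler0n R m) (sqr_ge0 a); nra.
Qed.

(* Were g positive at x, the integrals against the powers of a polynomial that
   peaks at x could not all vanish. *)
Lemma continuous_orthogonal_poly_le0 (g : S -> R) : continuous g ->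
  (forall p, \int[sigma]_x (g x * sphere_eval p x) = 0) -> forall x, g x <= 0.
Proof.
move=> cg g_orth x; rewrite leNgt; apply/negP => gx.
have [M M0 gM] := sphere_continuous_bounded cg.
have [e0 e0_gt0 cap0] : exists2 e, 0 < e &
    forall y, 1 - e < dot (sphere_val x) (sphere_val y) -> g x / 2 < g y.
  apply: sphere_nbhs_cap; apply: (cg x [set t | g x / 2 < t]).
  apply: open_nbhs_nbhs; split; first exact: open_gt.
  by rewrite /= ltr_pdivrMr // ltr_pMr // ltr1n.
pose e := Num.min e0 1.
have e_gt0 : 0 < e by rewrite lt_min e0_gt0 ltr01.
have e_le1 : e <= 1 by rewrite ge_min lexx orbT.
have cap y : 1 - e < dot (sphere_val x) (sphere_val y) -> g x / 2 < g y.
  by move=> xy; apply: cap0; apply: le_lt_trans xy; rewrite lerD2l lerN2 ge_min lexx.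
(* The peaking polynomial (1 + x.y) / (2 - e): nonnegative on the sphere, at most 1 outside the cap
   x.y > 1 - e, and at least 1 + a on the smaller cap A. The bound e <= 1 keeps the denominator
   positive. *)
pose p : mpoly.mpoly d.+1 R := mpoly.mpolyC d.+1 (2 - e)^-1 *
  (1 + \sum_i mpoly.mpolyC d.+1 (sphere_val x 0 i) * mpoly.mpolyX R (mpoly.mnm1 i)).
have pE y : sphere_eval p y = (1 + dot (sphere_val x) (sphere_val y)) / (2 - e).
  rewrite /sphere_eval mpoly.mevalM mpoly.mevalC mpoly.mevalD mpoly.meval1.
  rewrite raddf_sum /= mulrC dotE; congr ((1 + _) * _); apply: eq_bigr => i _.
  by rewrite mpoly.mevalM mpoly.mevalC mpoly.mevalXU.
have e2 : 0 < 2 - e by lra.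
pose A := [set y : S | 1 - e / 2 < dot (sphere_val x) (sphere_val y)].
have oA : open A.
  rewrite (_ : A = sphere_eval p @^-1` [set t | (2 - e / 2) / (2 - e) < t]).
    by have /continuousP := @sphere_eval_continuous R d p; apply; exact: open_gt.
  by apply/seteqP; split=> y; rewrite /A /= pE ltr_pM2r ?invr_gt0 //; lra.
have Ax : A x by rewrite /A /= dot_sphere; lra.
have sA : 0 < fine (sigma A).
  rewrite fine_gt0 // (sphere_open_measure_gt0 oA Ax) ltey_eq fin_num_measure //.
  exact: sphere_open_measurable.
pose a := (e / 2) / (2 - e).
have a0 : 0 < a by rewrite !divr_gt0.
(* g may be nonpositive only outside the large cap, where p^m <= 1; hence g p^m + M is nonnegative.
   Its integral is M by orthogonality, while on A it is at least (g(x) / 2) (1 + a)^m, which is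
   unbounded in m. *)
have bound m : g x / 2 * (1 + a) ^+ m * fine (sigma A) <= M.
  have cgp : continuous (fun y => g y * sphere_eval (p ^+ m) y).
    by apply: sphere_continuousM => //; exact: sphere_eval_continuous.
  have cgM : continuous (fun y => g y * sphere_eval (p ^+ m) y + M).
    by apply: sphere_continuousD => // y; exact: cst_continuous.
  have pmE y : sphere_eval (p ^+ m) y = sphere_eval p y ^+ m.
    by rewrite /sphere_eval rmorphXn.
  have -> : M = \int[sigma]_y (g y * sphere_eval (p ^+ m) y + M).
    have cM : continuous (fun _ : S => M) by move=> y; exact: cst_continuous.
    rewrite RintegralD //; try exact: continuous_integrable.
    rewrite g_orth add0r Rintegral_cst //.
    by have -> : fine (sigma setT) = 1; rewrite ?probability_setT ?mulr1.
  have uge0 y : 0 <= sphere_eval p y.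
    have /andP[lb _] := dot_sphere_bounds x y.
    by rewrite pE divr_ge0 ?(ltW e2) //; lra.
  apply: Rintegral_lower_bound => // [y||y Ay].
  - rewrite pmE; have [gy|gy] := leP 0 (g y).
      by rewrite addr_ge0 // mulr_ge0 // exprn_ge0.
    have u1 : sphere_eval p y ^+ m <= 1.
      rewrite exprn_ile1 // pE ler_pdivrMr // mul1r.
      have : ~ (1 - e < dot (sphere_val x) (sphere_val y)).
        by move=> /cap; rewrite ltNge (le_trans (ltW gy)) // divr_ge0 // ltW.
      by move/negP; rewrite -leNgt; lra.
    have := gM y; rewrite ltr0_norm // => gyM.
    have : - g y * sphere_eval p y ^+ m <= M.
      by rewrite (le_trans _ gyM) // ler_piMr // oppr_ge0 ltW.
    by rewrite mulNr; lra.
  - by rewrite mulr_ge0 ?divr_ge0 ?exprn_ge0 ?addr_ge0 // ltW.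
  - have gy : g x / 2 < g y by apply: cap; move: Ay; rewrite /A /=; lra.
    have uy : 1 + a <= sphere_eval p y.
      rewrite pE /a ler_pdivlMr // mulrDl mul1r divfK ?gt_eqF //.
      by move: Ay; rewrite /A /=; lra.
    have a1 : 0 <= 1 + a by rewrite addr_ge0 // ltW.
    rewrite -[leLHS]addr0 lerD // pmE ler_pM ?(ltW gy) ?exprn_ge0 //.
      by rewrite divr_ge0 // ltW.
    by rewrite lerXn2r ?nnegrE ?uge0.
pose K := g x / 2 * a * fine (sigma A).
have K0 : 0 < K by rewrite !mulr_gt0 ?invr_gt0.
have := bound (Num.truncn (M / K)).+1; apply/negP; rewrite -ltNge.
have := bernoulli_le (Num.truncn (M / K)).+1 (ltW a0).
set m := (Num.truncn (M / K)).+1 => bern.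
have : M / K < m%:R by exact: truncnS_gt.
rewrite ltr_pdivrMr // => /lt_le_trans; apply.
have -> : m%:R * K = g x / 2 * (m%:R * a) * fine (sigma A) by rewrite /K; ring.
apply: ler_wpM2r; first exact: ltW.
apply: ler_wpM2l; first by rewrite divr_ge0 // ltW.
by apply: le_trans bern; rewrite lerDr.
Qed.

Lemma continuous_orthogonal_poly (g : S -> R) : continuous g ->
  (forall p, \int[sigma]_x (g x * sphere_eval p x) = 0) -> forall x, g x = 0.
Proof.
move=> cg g_orth x; apply/eqP; rewrite eq_le continuous_orthogonal_poly_le0 //=.
have cN1 : continuous (fun _ : S => -1 : R) by move=> y; exact: cst_continuous.
rewrite -oppr_le0 -mulN1r.
apply: (continuous_orthogonal_poly_le0 (g := fun x => -1 * g x)) => [|p].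
  exact: sphere_continuousM.
under eq_Rintegral do rewrite -mulrA.
rewrite RintegralZl ?g_orth ?mulr0 //; apply: continuous_integrable.
by apply: sphere_continuousM => //; exact: sphere_eval_continuous.
Qed.

End L2Product.

(** * Spherical harmonics *)

Section PlaneRotation.
Variables (R : realType) (d : nat).
Local Notation S := (sphere R d).

Lemma dot_delta (x : 'rV[R]_d.+1) i : dot x (delta_mx 0 i) = x 0 i.
Proof.
rewrite dotE (bigD1 i) //= big1 => [|j /negbTE ji]; rewrite mxE.
  by rewrite !eqxx mulr1 addr0.
by rewrite ji andbF mulr0.
Qed.

(** The product of the reflections along e_i and along e_i + u e_j. These directions form the angle
    arctan u, so the product rotates by twice that angle. *)
Lemma rotation_plane (i j : 'I_d.+1) (u : R) : i != j ->
  exists2 U : 'M[R]_d.+1, rotation U & forall (x : 'rV[R]_d.+1) l,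
    (x *m U) 0 l = (1 + u ^+ 2)^-1 * plane_rot i j u (fun k => x 0 k) l.
Proof.
move=> ij; pose s := 1 + u ^+ 2.
have s0 : 0 < s by rewrite ltr_pwDl // sqr_ge0.
pose c := (Num.sqrt s)^-1.
have cc : c * c = s^-1 by rewrite -expr2 exprVn sqr_sqrtr // ltW.
pose w0 : 'rV[R]_d.+1 := u *: delta_mx 0 j + delta_mx 0 i.
have dotw x : dot x (c *: w0) = c * (x 0 i + u * x 0 j).
  rewrite dotC -[c *: w0]addr0 dotZDl dotZDl dotC dot_delta dotC dot_delta.
  by rewrite /dot mul0mx mxE; ring.
have w0i : w0 0 i = 1.
  by rewrite !mxE !eqxx (negbTE ij) mulr0 add0r.
have w0j : w0 0 j = u.
  by rewrite !mxE !eqxx eq_sym (negbTE ij) mulr1 addr0.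
have e1 : dot (delta_mx 0 i) (delta_mx 0 i) = 1 :> R.
  by rewrite dot_delta mxE !eqxx.
have w1 : dot (c *: w0) (c *: w0) = 1.
  rewrite dotw ![(c *: w0) 0 _]mxE w0i w0j.
  have -> : c * (c * 1 + u * (c * u)) = c * c * s by rewrite /s; ring.
  by rewrite cc mulVf // gt_eqF.
exists (reflection_mx (delta_mx 0 i) *m reflection_mx (c *: w0)).
  exact: rotation_reflections.
move=> x l; rewrite mulmxA !mul_reflection dot_delta dotw -/s.
rewrite !mxE !eqxx (eq_sym j) (negbTE ij) /= /plane_rot.
have -> : forall a b e, a - 2 * (c * b) * (c * e) = a - 2 * s^-1 * b * e.
  by move=> a b e; rewrite -cc; ring.
have sN : s != 0 by rewrite gt_eqF.
have [->|li] := eqVneq l i.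
  by rewrite (negbTE ij) /= /s; field.
have [->|lj] := eqVneq l j; first by rewrite /= /s; field.
by rewrite /= /s; field.
Qed.

End PlaneRotation.

Section HarmonicOrthogonality.
Variables (R : realType) (d : nat) (sigma : probability (sphere R d) R).
Hypotheses (d_gt0 : (0 < d)%N) (sigma_inv : rotation_invariant sigma).
Local Notation S := (sphere R d).
Local Notation mpol := (mpoly.mpoly d.+1 R).
Local Notation ev := (@sphere_eval R d).
Implicit Types p q h : mpol.

Definition pform p q : R := l2prod sigma (ev p) (ev q).

Lemma evD p q x : ev (p + q) x = ev p x + ev q x.
Proof. exact: mpoly.mevalD. Qed.

Lemma evM p q x : ev (p * q) x = ev p x * ev q x.
Proof. exact: mpoly.mevalM. Qed.

Lemma evZ a p x : ev (a *: p) x = a * ev p x.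
Proof. exact: mpoly.mevalZ. Qed.

Lemma ev_sum (I : Type) (s : seq I) (F : I -> mpol) x :
  ev (\sum_(i <- s) F i) x = \sum_(i <- s) ev (F i) x.
Proof. by rewrite /sphere_eval raddf_sum. Qed.

Lemma ev_L2 p : ev p \in Lfun sigma 2%:E.
Proof. exact/continuous_L2/sphere_eval_continuous. Qed.

Lemma ev_integrable p : sigma.-integrable setT (EFin \o ev p).
Proof. exact/continuous_integrable/sphere_eval_continuous. Qed.

Lemma pform_sym p q : pform p q = pform q p.
Proof. exact: l2prodC. Qed.

Lemma pformE p q : pform p q = \int[sigma]_x ev (p * q) x.
Proof. by apply: eq_Rintegral => x _; rewrite evM. Qed.

Lemma pform_lin a p q h : pform (a *: p + q) h = a * pform p h + pform q h.
Proof.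
rewrite /pform -l2prod_lin ?ev_L2 //; congr l2prod; apply/funext => x.
by rewrite evD evZ.
Qed.

Lemma pform_ge0 p : 0 <= pform p p.
Proof. exact: l2prod_ge0. Qed.

Lemma pform_eq0 p : pform p p = 0 -> forall x, ev p x = 0.
Proof.
move=> p0 x; apply/eqP; rewrite -sqrf_eq0 expr2; apply/eqP; move: x.
apply: (Rintegral_eq0 sigma_inv d_gt0) p0 => [|x].
  by apply: sphere_continuousM; exact: sphere_eval_continuous.
by rewrite -expr2 sqr_ge0.
Qed.

Lemma Rintegral_ev p : \int[sigma]_x ev p x = pform p 1.
Proof. by rewrite pformE mulr1. Qed.

Lemma horner_eq_poly (P Q : {poly R}) : (forall u, P.[u] = Q.[u]) -> P = Q.
Proof.
move=> PQ; apply/eqP; rewrite -subr_eq0; apply/eqP.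
pose rs := [seq i%:R | i <- iota 0 (size (P - Q))] : seq R.
apply: (@roots_geq_poly_eq0 _ _ rs).
- by apply/allP => u _; rewrite rootE hornerD hornerN PQ subrr.
- by rewrite map_inj_uniq ?iota_uniq //; exact: mulrIn (oner_neq0 _).
- by rewrite size_map size_iota.
Qed.

Lemma Rintegral_mangular_homog k i j p : p \is mpoly.ishomog1 k mpoly.mdeg ->
  pform (mangular i j p) 1 = 0.
Proof.
move=> pk; have [->|ij] := eqVneq i j.
  by rewrite /mangular subrr (bform0l pform_lin).
have [q [q0 q1 qe]] := meval_plane_rot p ij.
pose Q := \poly_(m < size q) pform q`_m 1.
pose P := pform p 1 *: (1 + 'X^2) ^+ k.
have QP : Q = P.
  apply: horner_eq_poly => u.
  have [U rU Ue] := rotation_plane u ij.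
  have s0 : 1 + u ^+ 2 != 0 by rewrite gt_eqF // ltr_pwDl // sqr_ge0.
  have evU x : (1 + u ^+ 2) ^+ k * ev p (rotate U x) =
      ev (\sum_(m < size q) u ^+ m *: q`_m) x.
    rewrite /sphere_eval rotateE // -meval_homogZ //.
    transitivity (mpoly.meval (fun i0 => sphere_val x 0 i0) q.[mpoly.mpolyC d.+1 u]).
      rewrite -qe; apply: mpoly.meval_eq => l.
      by rewrite Ue mulrA mulfV // mul1r.
    rewrite horner_coef; congr mpoly.meval; apply: eq_bigr => m _.
    by rewrite -rmorphXn mulrC mpoly.mul_mpolyC.
  rewrite horner_poly /P hornerZ horner_exp hornerD hornerXn hornerC.
  rewrite -(Rintegral_ev p) -(Rintegral_rotate sigma_inv rU (@sphere_eval_continuous _ _ p)).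
  rewrite mulrC -RintegralZl //; last first.
    apply: continuous_integrable => x.
    apply: (@continuous_comp S S R); first exact: rotate_continuous.
    exact: sphere_eval_continuous.
  under [RHS]eq_Rintegral do rewrite evU.
  rewrite Rintegral_ev (bform_suml pform_lin).
  by apply: eq_bigr => m _; rewrite mulrC.
have : Q`_1 = P`_1 by rewrite QP.
have -> : P`_1 = 0.
  rewrite -[P`_1]mulr1n -coef_deriv -horner_coef0 derivZ hornerZ deriv_exp.
  rewrite derivD derivXn derivC hornerMn hornerM hornerD hornerMn hornerXn.
  by rewrite hornerC expr0n mul0rn add0r !(mulr0, mul0r, mul0rn).
have q1E : q`_1 = 2 *: mangular i j p.
  by rewrite q1 -mpoly.mul_mpolyC mpoly.mpolyC_nat.
have -> : Q`_1 = pform q`_1 1.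
  rewrite coef_poly; case: ltnP => // qs.
  by rewrite nth_default // (bform0l pform_lin).
rewrite q1E -[2 *: _]addr0 pform_lin (bform0l pform_lin) addr0 => /eqP.
by rewrite mulf_eq0 pnatr_eq0 => /eqP.
Qed.

Lemma Rintegral_mangular i j p : pform (mangular i j p) 1 = 0.
Proof.
elim/mpoly.mpolyind: p => [|c m p _ _ IHp].
  apply: (@Rintegral_mangular_homog 0); exact: mpoly.dhomog0.
have mangZ : mangular i j (c *: mpoly.mpolyX R m) = c *: mangular i j (mpoly.mpolyX R m).
  by rewrite /mangular !mpoly.mderivZ scalerBr -!scalerAr.
rewrite mangularD mangZ pform_lin IHp addr0.
rewrite (@Rintegral_mangular_homog (mpoly.mdeg m)) ?mulr0 //.
by rewrite mpoly.dhomogX.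
Qed.

(** Integration by parts: [mangular i j] is a derivation whose values have integral zero. *)
Lemma pform_mangular i j p q :
  pform (mangular i j p) q = - pform p (mangular i j q).
Proof.
apply/eqP; rewrite -addr_eq0 !pformE -!pformE; apply/eqP.
have pE u v : pform u v = pform (u * v) 1 by rewrite !pformE mulr1.
rewrite pE [X in _ + X]pE -[X in X + _]mul1r -pform_lin scale1r -mangularM.
exact: Rintegral_mangular.
Qed.

Lemma pform_suml (I : Type) (s : seq I) (F : I -> mpol) q :
  pform (\sum_(i <- s) F i) q = \sum_(i <- s) pform (F i) q.
Proof.
elim: s => [|i s IHs]; first by rewrite !big_nil (bform0l pform_lin).
by rewrite !big_cons -[F i in LHS]scale1r pform_lin mul1r IHs.
Qed.

Lemma pform_mangular2 p q :
  pform (\sum_i \sum_j mangular i j (mangular i j p)) q =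
  pform p (\sum_i \sum_j mangular i j (mangular i j q)).
Proof.
rewrite [RHS]pform_sym !pform_suml; apply: eq_bigr => i _.
rewrite !pform_suml; apply: eq_bigr => j _.
by rewrite pform_mangular [RHS]pform_mangular pform_sym.
Qed.

Definition eigen (k : nat) : R := k%:R * (k%:R + d%:R - 1).

Lemma eigen_inj : injective eigen.
Proof.
have lt j k : (j < k)%N -> eigen j < eigen k.
  move=> jk; rewrite /eigen; have d1 : 1 <= d%:R :> R by rewrite ler1n.
  have : j%:R + 1 <= k%:R :> R by rewrite natr1 ler_nat.
  by have := ler0n R j; nra.
move=> j k jk; case: (ltngtP j k) => [/lt|/lt|//]; by rewrite jk ltxx.
Qed.

(** The two polynomials are eigenvectors of the symmetric operator of [pform_mangular2], with
    distinct eigenvalues. *)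
Lemma harmonic_orthogonal j k p q :
  p \is mpoly.ishomog1 j mpoly.mdeg -> mlaplacian p = 0 ->
  q \is mpoly.ishomog1 k mpoly.mdeg -> mlaplacian q = 0 -> j != k ->
  pform p q = 0.
Proof.
move=> pj p0 qk q0 jk; have := pform_mangular2 p q.
rewrite (sum_mangular2_harmonic pj p0) (sum_mangular2_harmonic qk q0).
rewrite -[X in pform X q]addr0 -[X in pform p X]addr0 (pform_sym p) !pform_lin.
rewrite !(bform0l pform_lin) !addr0 (pform_sym q) => /eqP.
rewrite -subr_eq0 -mulrBl mulf_eq0 => /orP[/eqP e|/eqP //].
case/eqP: jk; apply: eigen_inj; rewrite /eigen; move: e; rewrite -natr1; lra.
Qed.

(** Multiplication by |x|^2 does not change the restriction to the sphere, so [harmonic_span_ind]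
    applies to every homogeneous component of p. *)
Lemma harmonic_decomposition n p : (mpoly.msize p <= n.+1)%N ->
  exists h : nat -> mpol, (forall k, h k \is mpoly.ishomog1 k mpoly.mdeg /\
    mlaplacian (h k) = 0) /\ forall x, ev p x = \sum_(k < n.+1) ev (h k) x.
Proof.
move=> pn; pose P (p : mpol) := exists h : nat -> mpol,
  (forall k, h k \is mpoly.ishomog1 k mpoly.mdeg /\ mlaplacian (h k) = 0) /\
  forall x, ev p x = \sum_(k < n.+1) ev (h k) x.
have lap0 : mlaplacian 0 = 0 :> mpol.
  by rewrite -(scale0r (0 : mpol)) mlaplacianZ !scale0r.
have PL a p1 p2 : P p1 -> P p2 -> P (a *: p1 + p2).
  move=> [h1 [hh1 e1]] [h2 [hh2 e2]]; exists (fun k => a *: h1 k + h2 k); split.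
    move=> k; have [h1k h10] := hh1 k; have [h2k h20] := hh2 k; split.
      by rewrite rpredD // mpoly.dhomogZ.
    by rewrite mlaplacianD mlaplacianZ h10 h20 scaler0 addr0.
  move=> x; rewrite evD evZ e1 e2 mulr_sumr -big_split /=.
  by apply: eq_bigr => k _; rewrite evD evZ.
have P0 : P 0.
  exists (fun _ => 0); split=> [k|x]; first by rewrite mpoly.dhomog0.
  by rewrite big1 // /sphere_eval mpoly.meval0.
have Phom j q : (j <= n)%N -> q \is mpoly.ishomog1 j mpoly.mdeg -> P q.
  apply: harmonic_span_ind => // [q1 [h [hh e]]|i h jn hi h0].
    exists h; split=> // x; rewrite evM e -[RHS]mul1r; congr (_ * _).
    rewrite /sqnorm_mpoly ev_sum -(dot_sphere x) dotE; apply: eq_bigr => k _.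
    by rewrite /sphere_eval expr2 mpoly.mevalM mpoly.mevalXU.
  exists (fun k => if k == i then h else 0); split=> [k|x].
    by case: eqVneq => [->|_] //; rewrite mpoly.dhomog0.
  have i_lt : (i < n.+1)%N by rewrite ltnS.
  rewrite (bigD1 (Ordinal i_lt)) //= eqxx big1 ?addr0 // => k.
  by rewrite -val_eqE /= => /negbTE ->; rewrite /sphere_eval mpoly.meval0.
rewrite (mpoly.pihomog_partitionE (mf := mpoly.mdeg) pn).
elim/big_ind: _ => [//|p1 p2 Pp1 Pp2|k _]; first by rewrite -[p1]scale1r; exact: PL.
by apply: (Phom k); [rewrite -ltnS|exact: mpoly.pihomogP].
Qed.

End HarmonicOrthogonality.

(** * Reproducing kernels *)

Section OrthonormalBasis.
Variables (R : realType) (d n : nat).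
Local Notation S := (sphere R d).
Local Notation mpol := (mpoly.mpoly d.+1 R).
Local Notation ev := (@sphere_eval R d).
Implicit Types p q : mpol.

Variable b : mpol -> mpol -> R.
Hypothesis b_sym : forall p q, b p q = b q p.
Hypothesis b_lin : forall a p q h, b (a *: p + q) h = a * b p h + b q h.
Hypothesis b_ge0 : forall p, 0 <= b p p.
Hypothesis b_null : forall p, (forall x, ev p x = 0) -> b p p = 0.
Hypothesis b_def : forall p, (mpoly.msize p <= n.+1)%N -> b p p = 0 ->
  forall x, ev p x = 0.

(** The form b is abstract because it will be both the L_2 form and the sampling form. The latter is
    definite only up to degree n, whence the degree bound in [b_def]. Multiples of |x|^2 - 1 are
    null for b, so the restricted monomials are enough to expand under b; definiteness then turns
    this into an expansion on the sphere. *)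
Lemma orthonormal_basis : exists u : seq mpol,
  [/\ (size u <= 2 * n.+1 ^ d)%N, uniq u,
      {in u, forall p, (mpoly.msize p <= n.+1)%N},
      {in u &, forall p q, b p q = (p == q)%:R}
    & forall p, (mpoly.msize p <= n.+1)%N ->
        forall x, ev p x = \sum_(q <- u) b p q * ev q x].
Proof.
have [u [su uu ou Su eu]] := gram_schmidt b_sym b_lin b_ge0 (restricted_monomials R d n).
have un : {in u, forall p, (mpoly.msize p <= n.+1)%N}.
  apply: Su (lin_closed_msize _ _ _) _ => p; exact: msize_restricted_monomials.
exists u; split=> // [|p pn x].
  exact: leq_trans su (size_restricted_monomials _ _ _).
have ep z : b p z = \sum_(w <- u) b p w * b w z.
  move: p pn z {x}; apply: restricted_monomials_span => [|q z|//].
    split=> [z|a p1 p2 e1 e2 z].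
      by rewrite (bform0l b_lin) big1 // => w _; rewrite (bform0l b_lin) mul0r.
    rewrite b_lin e1 e2 mulr_sumr -big_split; apply: eq_bigr => w _ /=.
    by rewrite b_lin mulrDl mulrA.
  have q0 : forall w, b ((sqnorm_mpoly R d.+1 - 1) * q) w = 0.
    apply: (bform_null b_sym b_lin b_ge0); apply: b_null => x.
    rewrite evM; have -> : ev (sqnorm_mpoly R d.+1 - 1) x = 0.
      rewrite /sphere_eval mpoly.mevalB mpoly.meval1 -(dot_sphere x) dotE.
      rewrite /sqnorm_mpoly raddf_sum -sumrB big1 // => i _ /=.
      by rewrite expr2 mpoly.mevalM mpoly.mevalXU subrr.
    by rewrite mul0r.
  by rewrite q0 big1 // => w _; rewrite q0 mul0r.
pose s := \sum_(w <- u) b p w *: w.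
have [S0 SL] := lin_closed_msize R d.+1 n.+1.
have sn : (mpoly.msize s <= n.+1)%N.
  rewrite /s big_seq; elim/big_ind: _ => [//|p1 p2 p1n p2n|w wu].
    by rewrite -[p1]scale1r; exact: SL.
  by rewrite -[_ *: _]addr0; apply: SL => //; exact: un.
have rn : (mpoly.msize (-1 *: s + p)%R <= n.+1)%N by exact: SL.
have r0 z : b (-1 *: s + p) z = 0.
  by rewrite b_lin /s (bform_suml b_lin) ep mulN1r addNr.
have := b_def rn (r0 _) x; rewrite evD evZ mulN1r addrC => /eqP.
rewrite subr_eq0 => /eqP ->; rewrite /s ev_sum.
by apply: eq_bigr => w _; rewrite evZ.
Qed.

Lemma reproducing_kernel : exists (m : nat) (K : S -> mpol),
  [/\ (m <= 2 * n.+1 ^ d)%N,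
      forall y, (mpoly.msize (K y) <= n.+1)%N,
      forall p, (mpoly.msize p <= n.+1)%N -> forall y, ev p y = b p (K y)
    & exists2 u : seq mpol, size u = m & [/\ uniq u,
        {in u &, forall p q, b p q = (p == q)%:R},
        forall y, K y = \sum_(w <- u) ev w y *: w
      & forall p, (mpoly.msize p <= n.+1)%N ->
        forall x, ev p x = \sum_(q <- u) b p q * ev q x]].
Proof.
have [u [su uu un ou eu]] := orthonormal_basis.
exists (size u), (fun y => \sum_(w <- u) ev w y *: w); split=> //; last by exists u.
- move=> y; rewrite big_seq; have [S0 SL] := lin_closed_msize R d.+1 n.+1.
  elim/big_ind: _ => [//|p1 p2 p1n p2n|w wu].
    by rewrite -[p1]scale1r; exact: SL.
  by rewrite -[_ *: _]addr0; apply: SL => //; exact: un.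
- move=> p pn y; rewrite b_sym (bform_suml b_lin) eu //.
  by apply: eq_bigr => w _; rewrite mulrC b_sym.
Qed.

(** Expanding each [l i] in u and evaluating at the points factors an identity matrix of size [#|I|]
    through dimension [size u]. *)
Lemma size_interpolation (I : finType) (u : seq mpol) (l : I -> mpol) (x : I -> S) :
  (forall p, (mpoly.msize p <= n.+1)%N ->
     forall x, ev p x = \sum_(q <- u) b p q * ev q x) ->
  (forall i, (mpoly.msize (l i) <= n.+1)%N) ->
  (forall i j, (ev (l i) (x j) == 0) = (i != j)) ->
  (#|I| <= size u)%N.
Proof.
move=> eu ln lx.
pose A := \matrix_(i < #|I|, j < size u)
  ((ev (l (enum_val i)) (x (enum_val i)))^-1 * b (l (enum_val i)) (tnth (in_tuple u) j)).
pose B := \matrix_(j < size u, i < #|I|) ev (tnth (in_tuple u) j) (x (enum_val i)).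
apply: (@mulmx1_min _ _ _ A B); apply/matrixP => i k; rewrite !mxE.
under eq_bigr do rewrite !mxE -mulrA.
rewrite -mulr_sumr -(big_tnth _ _ u xpredT (fun q => b (l (enum_val i)) q * ev q (x (enum_val k)))).
rewrite -eu //; case: eqVneq => [->|ik].
  by rewrite mulVf // lx eqxx.
apply/eqP; rewrite mulf_eq0 lx; apply/orP; right.
by apply: contra_neq ik => /enum_val_inj.
Qed.

End OrthonormalBasis.

(** * Interpolation on a grid: lower bound for the dimension *)

Section InterpolationNodes.
Variables (R : realType) (d n : nat).
Hypothesis d_gt0 : (0 < d)%N.
Local Notation S := (sphere R d).
Local Notation mpol := (mpoly.mpoly d.+1 R).
Local Notation ev := (@sphere_eval R d).
(** The largest m with d m <= n: the interpolating polynomials have degree m in each of d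
    coordinates. *)
Let m := (n %/ d)%N.

(** The values are at most 1/d, so that the squares of any d of them sum to at most 1 and the first
    coordinate can be solved for on the sphere. *)
Definition grid (j : 'I_m.+1) : R := j%:R / (m.+1 * d)%:R.

Lemma grid_inj : injective grid.
Proof.
move=> i j; have md : (m.+1 * d)%:R != 0 :> R by rewrite pnatr_eq0; lia.
move=> /(congr1 (fun t => t * (m.+1 * d)%:R)); rewrite /grid !divfK //.
by move/eqP; rewrite eqr_nat => /eqP /val_inj.
Qed.

Lemma grid_node (a : {ffun 'I_d -> 'I_m.+1}) :
  exists x : S, forall i, sphere_val x 0 (lift ord0 i) = grid (a i).
Proof.
pose s := \sum_(i < d) grid (a i) ^+ 2.
have s1 : s <= 1.
  have d0 : (0 : R) < d%:R by rewrite ltr0n.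
  apply: (@le_trans _ _ (\sum_(i < d) d%:R^-1)); last first.
    by rewrite sumr_const card_ord -(mulr_natr d%:R^-1) mulVf ?gt_eqF.
  apply: ler_sum => i _; have g0 : 0 <= grid (a i) by rewrite divr_ge0.
  have g1 : grid (a i) <= d%:R^-1.
    rewrite /grid natrM invfM mulrA ler_piMl ?invr_ge0 ?ler0n //.
    by rewrite ler_pdivrMr ?ltr0n // mul1r ler_nat ltnW.
  have : d%:R^-1 <= 1 :> R by rewrite invf_le1 // ler1n.
  by move: (d%:R^-1) g1 => c; nra.
pose v : 'rV[R]_d.+1 :=
  \row_i if unlift ord0 i is Some j then grid (a j) else Num.sqrt (1 - s).
have vv : dot v v = 1.
  rewrite dotE big_ord_recl mxE unlift_none -expr2 sqr_sqrtr ?subr_ge0 //.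
  rewrite [X in _ + X](_ : _ = s) ?subrK //.
  by apply: eq_bigr => i _; rewrite mxE liftK expr2.
have [x xv] := sphere_of_dot vv; exists x => i.
by rewrite xv mxE liftK.
Qed.

(** A tensor product of Lagrange polynomials in the last d coordinates. Only its zeros matter;
    [size_interpolation] divides by the value at the node. *)
Definition lagrange (a : {ffun 'I_d -> 'I_m.+1}) : mpol :=
  \prod_(i < d) \prod_(j < m.+1 | j != a i)
    (mpoly.mpolyX R (mpoly.mnm1 (lift ord0 i)) - mpoly.mpolyC d.+1 (grid j)).

Lemma msize_lagrange a : (mpoly.msize (lagrange a) <= n.+1)%N.
Proof.
have lin i c : (mpoly.msize (mpoly.mpolyX R (mpoly.mnm1 i)
    - mpoly.mpolyC d.+1 c)%R <= 2)%N.
  rewrite (leq_trans (mpoly.msizeD_le _ _)) // mpoly.msizeN geq_max.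
  rewrite mpoly.msizeX mpoly.mdeg1 mpoly.msizeC /=.
  by case: (c != 0).
have inner i : (mpoly.msize (\prod_(j < m.+1 | j != a i)
    (mpoly.mpolyX R (mpoly.mnm1 (lift ord0 i)) - mpoly.mpolyC d.+1 (grid j))) <= m.+1)%N.
  apply: (leq_trans (msize_prod_leq _ (k := fun _ => 1%N) _)) => [j _|]; first exact: lin.
  rewrite ltnS sum1_card; have := cardC1 (a i); rewrite card_ord /= => e.
  by rewrite (eq_card (B := predC1 (a i))) ?e.
apply: (leq_trans (msize_prod_leq _ (k := fun _ => m) _)) => [i _|]; first exact: inner.
by rewrite sum_nat_const card_ord mulnC ltnS leq_trunc_div.
Qed.

Lemma dimension_lower_bound (b : mpol -> mpol -> R) (u : seq mpol) :
  (forall p, (mpoly.msize p <= n.+1)%N ->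
     forall x, ev p x = \sum_(q <- u) b p q * ev q x) ->
  (m.+1 ^ d <= size u)%N.
Proof.
move=> eu; pose x a := projT1 (cid (grid_node a)).
have xE a i : sphere_val (x a) 0 (lift ord0 i) = grid (a i).
  exact: projT2 (cid (grid_node a)) i.
have -> : (m.+1 ^ d = #|{ffun 'I_d -> 'I_m.+1}|)%N by rewrite card_ffun !card_ord.
apply: (size_interpolation eu msize_lagrange (x := x)) => a c.
have -> : ev (lagrange a) (x c) =
    \prod_(i < d) \prod_(j < m.+1 | j != a i) (grid (c i) - grid j).
  rewrite /sphere_eval rmorph_prod; apply: eq_bigr => i _.
  rewrite rmorph_prod; apply: eq_bigr => j _ /=.
  by rewrite mpoly.mevalB mpoly.mevalXU mpoly.mevalC xE.
apply/eqP/idP => [/eqP|].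
  rewrite prodf_seq_eq0 => /hasP[i _ /=].
  rewrite prodf_seq_eq0 => /hasP[j _ /= /andP[ja]].
  rewrite subr_eq0 => /eqP /grid_inj cj.
  by apply: contraNneq ja => ->; rewrite cj.
move=> ac; have [i ic] : exists i, a i != c i.
  apply/existsP; rewrite -negb_forall; apply: contraNN ac => /forallP ac.
  by apply/eqP/ffunP => i; apply/eqP.
apply/eqP; rewrite prodf_seq_eq0; apply/hasP; exists i; rewrite ?mem_index_enum //=.
rewrite prodf_seq_eq0; apply/hasP; exists (c i); rewrite ?mem_index_enum //=.
by rewrite eq_sym ic subrr eqxx.
Qed.

End InterpolationNodes.

(** * The kernel for the rotation invariant measure *)

Section SphereKernel.
Variables (R : realType) (d : nat) (sigma : probability (sphere R d) R).
Hypotheses (d_gt0 : (0 < d)%N) (sigma_inv : rotation_invariant sigma).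
Local Notation S := (sphere R d).
Local Notation mpol := (mpoly.mpoly d.+1 R).
Local Notation ev := (@sphere_eval R d).
Implicit Types p q : mpol.

Lemma ev_rotate n U p : rotation U -> (mpoly.msize p <= n.+1)%N ->
  exists2 q, (mpoly.msize q <= n.+1)%N & forall x, ev q x = ev p (rotate U x).
Proof.
move=> rU pn; pose L i : mpol :=
  \sum_k U k i *: mpoly.mpolyX R (mpoly.mnm1 k).
have L2 i : (mpoly.msize (L i) <= 2)%N.
  have [S0 SL] := lin_closed_msize R d.+1 2.
  rewrite /L; elim/big_ind: _ => [//|p1 p2 p1n p2n|k _].
    by rewrite -[p1]scale1r; exact: SL.
  rewrite -[_ *: _]addr0; apply: SL => //.
  by rewrite mpoly.msizeX mpoly.mdeg1.
have [q qn qE] := linear_substitution L2 pn; exists q => // x.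
rewrite /sphere_eval qE; apply: mpoly.meval_eq => i.
rewrite rotateE // mxE /L raddf_sum; apply: eq_bigr => k _ /=.
by rewrite mpoly.mevalZ mpoly.mevalXU mulrC.
Qed.

(** The diagonal of the kernel is constant by invariance, and its integral is the sum of the squared
    norms of an orthonormal basis, that is, the number m of its elements. *)
Lemma sphere_kernel n : exists (m : nat) (K : S -> mpol),
  [/\ ((n %/ d).+1 ^ d <= m <= 2 * n.+1 ^ d)%N,
      forall y, (mpoly.msize (K y) <= n.+1)%N,
      forall p, (mpoly.msize p <= n.+1)%N -> forall y, ev p y = pform sigma p (K y)
    & forall y, ev (K y) y = m%:R].
Proof.
have bdef p : (mpoly.msize p <= n.+1)%N -> pform sigma p p = 0 -> forall x, ev p x = 0.
  by move=> _; exact: pform_eq0.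
have bnull p : (forall x, ev p x = 0) -> pform sigma p p = 0.
  move=> p0; rewrite /pform /l2prod; under eq_Rintegral do rewrite p0 mul0r.
  by rewrite Rintegral_cst // mul0r.
have [m [K [mn Kn Krep [u um [uu ou KE eu]]]]] :=
  reproducing_kernel (pform_sym sigma) (pform_lin sigma) (pform_ge0 sigma) bnull bdef.
(* The rotated kernel q has q(y) = K(z,z) and squared norm K(z,z), so Cauchy-Schwarz against [K y]
   gives K(z,z)^2 <= K(z,z) K(y,y). Equality follows by rotating back. *)
have diag_le U y : rotation U -> ev (K (rotate U y)) (rotate U y) <= ev (K y) y.
  move=> rU; set z := rotate U y.
  have [q qn qE] := ev_rotate rU (Kn z).
  have KK x : pform sigma (K x) (K x) = ev (K x) x by rewrite -Krep.
  have qq : pform sigma q q = ev (K z) z.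
    rewrite -KK /pform /l2prod.
    under eq_Rintegral do rewrite qE.
    apply: (Rintegral_rotate sigma_inv rU (f := fun x => ev (K z) x * ev (K z) x)).
    by apply: sphere_continuousM; exact: sphere_eval_continuous.
  have := bform_cauchy_schwarz (pform_sym sigma) (pform_lin sigma) (pform_ge0 sigma) q (K y).
  rewrite -Krep // qE -/z qq KK expr2.
  have : 0 <= ev (K z) z by rewrite -KK pform_ge0.
  rewrite le_eqVlt => /predU1P[<- _|z0]; first by rewrite -KK pform_ge0.
  by rewrite ler_pM2l.
have diag x y : ev (K y) y = ev (K x) x.
  apply/eqP; rewrite eq_le.
  have [U rU Uy] := rotation_transitive x y d_gt0.
  have [V rV Vx] := rotation_transitive y x d_gt0.
  by have := diag_le U x rU; rewrite Uy => ->; have := diag_le V y rV; rewrite Vx => ->.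
exists m, K; split=> //; first by rewrite mn andbT -um (dimension_lower_bound d_gt0 eu).
move=> y; have L1 p : pform sigma p 1 = \int[sigma]_x ev p x by rewrite Rintegral_ev.
have : \int[sigma]_x ev (K x) x = m%:R.
  have -> : \int[sigma]_x ev (K x) x = pform sigma (\sum_(w <- u) w * w) 1.
    rewrite L1; apply: eq_Rintegral => x _; rewrite KE !ev_sum.
    by apply: eq_bigr => w _; rewrite evZ evM.
  rewrite pform_suml big_seq -um -sum1_size natr_sum [RHS]big_seq.
  by apply: eq_bigr => w wu; rewrite L1 -pformE ou // eqxx.
have -> : \int[sigma]_x ev (K x) x = \int[sigma]_x (cst (ev (K y) y)) x.
  by apply: eq_Rintegral => x _; rewrite (diag y x).
rewrite Rintegral_cst //.
by have -> : fine (sigma setT) = 1; rewrite ?probability_setT ?mulr1.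
Qed.

End SphereKernel.

(** * Sampling of polynomials and harmonic projections *)

Section Sampling.
Variables (R : realType) (d : nat) (sigma : probability (sphere R d) R).
Hypotheses (d_gt0 : (0 < d)%N) (sigma_inv : rotation_invariant sigma).
Local Notation S := (sphere R d).
Local Notation mpol := (mpoly.mpoly d.+1 R).
Local Notation ev := (@sphere_eval R d).
Implicit Types p q : mpol.

Lemma ev_sqr_le n p x : (mpoly.msize p <= n.+1)%N ->
  ev p x ^+ 2 <= (2 * n.+1 ^ d)%:R * pform sigma p p.
Proof.
have [m [K [/andP[_ mn] Kn Krep Kdiag]]] := sphere_kernel d_gt0 sigma_inv n => pn.
rewrite Krep // (le_trans (bform_cauchy_schwarz (pform_sym sigma) (pform_lin sigma)
  (pform_ge0 sigma) _ _)) // mulrC -Krep // Kdiag.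
by rewrite ler_wpM2r ?pform_ge0 // ler_nat.
Qed.

(** The ratio of the two dimensions appears through its explicit bound in n, N and d. *)
Lemma sampling_upper_bound n N m (x : 'I_m -> S) (tau : 'I_m -> R) (B : R) p :
  0 <= B -> (forall k, 0 <= tau k) ->
  (forall q, (mpoly.msize q <= n.+1)%N ->
    \sum_k ev q (x k) ^+ 2 * tau k <= B * pform sigma q q) ->
  (mpoly.msize p <= N.+1)%N ->
  \sum_k ev p (x k) ^+ 2 * tau k <=
  B * ((2 * (N + n).+1 ^ d)%:R / ((n %/ d).+1 ^ d)%:R) * pform sigma p p.
Proof.
move=> B0 tau0 MZ pN.
have [M [K [/andP[nM _] Kn Krep Kdiag]]] := sphere_kernel d_gt0 sigma_inv n.
have [M' [K' [/andP[_ M'n] Kn' Krep' Kdiag']]] := sphere_kernel d_gt0 sigma_inv (N + n).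
have M0 : (0 : R) < M%:R by rewrite ltr0n (leq_trans _ nM) // expn_gt0.
(* Symmetry turns the values at z of the many polynomials [K (x k)] into the values at the nodes of
   the single polynomial [K z]. *)
have Ksym y z : ev (K y) z = ev (K z) y.
  by rewrite (Krep _ (Kn y)) pform_sym -Krep.
have step k : M%:R ^+ 2 * ev p (x k) ^+ 2 <=
    M'%:R * pform sigma (p * K (x k)) (p * K (x k)).
  have pKn : (mpoly.msize (p * K (x k))%R <= (N + n).+1)%N by exact: msizeM_leq.
  rewrite -exprMn mulrC -(Kdiag (x k)) -evM Krep' //.
  by rewrite (le_trans (bform_cauchy_schwarz (pform_sym sigma) (pform_lin sigma)
    (pform_ge0 sigma) _ _)) // mulrC -Krep' // Kdiag'.
have sumK : \sum_k tau k * pform sigma (p * K (x k)) (p * K (x k)) <=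
    B * M%:R * pform sigma p p.
  pose G := \sum_k tau k *: ((p * K (x k)) * (p * K (x k))).
  have -> : \sum_k tau k * pform sigma (p * K (x k)) (p * K (x k)) = \int[sigma]_z ev G z.
    rewrite Rintegral_ev (bform_suml (pform_lin sigma)).
    by apply: eq_bigr => k _; rewrite -Rintegral_ev -pformE.
  have -> : B * M%:R * pform sigma p p = \int[sigma]_z ev ((B * M%:R) *: (p * p)) z.
    by rewrite Rintegral_ev -[_ *: _]addr0 pform_lin (bform0l (pform_lin sigma)) addr0
      -Rintegral_ev -pformE.
  apply: le_Rintegral => // [||z _]; [exact: ev_integrable|exact: ev_integrable|].
  rewrite /G ev_sum evZ evM.
  have -> : \sum_k ev (tau k *: ((p * K (x k)) * (p * K (x k)))) z =
      (\sum_k ev (K z) (x k) ^+ 2 * tau k) * (ev p z * ev p z).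
    rewrite mulr_suml; apply: eq_bigr => k _.
    by rewrite evZ !evM (Ksym (x k)); ring.
  apply: ler_wpM2r; first by rewrite -expr2 sqr_ge0.
  by rewrite (le_trans (MZ _ (Kn z))) // -Krep // Kdiag.
have : M%:R ^+ 2 * \sum_k ev p (x k) ^+ 2 * tau k <= M'%:R * (B * M%:R * pform sigma p p).
  apply: le_trans (ler_wpM2l (ler0n _ _) sumK).
  rewrite !mulr_sumr; apply: ler_sum => k _.
  by have := ler_wpM2l (tau0 k) (step k); congr (_ <= _); ring.
have -> : M'%:R * (B * M%:R * pform sigma p p) =
   M%:R ^+ 2 * (B * (M'%:R / M%:R) * pform sigma p p) by field; rewrite gt_eqF.
rewrite ler_pM2l ?exprn_gt0 // => /le_trans; apply.
rewrite ler_wpM2r ?pform_ge0 // ler_wpM2l // ler_pM ?invr_ge0 ?ler0n ?ler_nat //.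
by rewrite lef_pV2 ?posrE ?ler_nat // ltr0n expn_gt0.
Qed.

End Sampling.

(** * Polynomials as smooth test functions *)

Section SmoothEval.
Variables (R : realType) (d : nat).
Local Notation mpol := (mpoly.mpoly d.+1 R).
Implicit Types p q : mpol.

Definition row_eval p (x : 'rV[R]_d.+1) : R := mpoly.meval (fun i => x 0 i) p.

Lemma row_eval_derive p (i : 'I_d.+1) x :
  is_derive x (delta_mx 0 i) (row_eval p) (row_eval (mpoly.mderiv i p) x).
Proof.
elim/mpoly_ring_ind: p => [c|j|p q dp dq|p q dp dq].
- rewrite (_ : row_eval _ = cst c); last first.
    by apply/funext => y; rewrite /row_eval mpoly.mevalC.
  rewrite mpoly.mderivC /row_eval mpoly.meval0.
  exact: is_derive_cst.
- rewrite (_ : row_eval _ = fun y => y 0 j); last first.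
    by apply/funext => y; rewrite /row_eval mpoly.mevalXU.
  rewrite mderivXU.
  have quot : (fun h => h^-1 *: (((fun y : 'rV[R]_d.+1 => y 0 j) \o shift x)
      (h *: delta_mx 0 i) - x 0 j)) @ 0^' --> ((i == j)%:R : R).
    apply: cvg_near_cst; near=> h.
    have h0 : h != 0 by near: h; exact: nbhs_dnbhs_neq.
    rewrite /= !mxE addrK eqxx /= eq_sym /GRing.scale /= mulKf //.
  rewrite (_ : row_eval _ x = (i == j)%:R); last first.
    by rewrite /row_eval rmorph_nat.
  apply: DeriveDef; first by apply/cvg_ex; exists (i == j)%:R.
  exact: cvg_lim quot.
- rewrite (_ : row_eval _ = row_eval p \+ row_eval q); last first.
    by apply/funext => y; rewrite /row_eval mpoly.mevalD.
  rewrite mpoly.mderivD /row_eval mpoly.mevalD.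
  exact: is_deriveD.
- rewrite (_ : row_eval _ = row_eval p * row_eval q); last first.
    by apply/funext => y; rewrite /row_eval mpoly.mevalM.
  rewrite mpoly.mderivM /row_eval mpoly.mevalD !mpoly.mevalM.
  apply: is_derive_eq (is_deriveM dp dq) _.
  by rewrite /GRing.scale /=; rewrite /row_eval; ring.
Unshelve. all: by end_near.
Qed.

Lemma row_eval_continuous p : continuous (row_eval p).
Proof.
elim/mpoly_ring_ind: p => [c|j|p q cp cq|p q cp cq] x.
- rewrite (_ : row_eval _ = cst c); first exact: cst_continuous.
  by apply/funext => y; rewrite /row_eval mpoly.mevalC.
- rewrite (_ : row_eval _ = fun y => y 0 j); first exact: coord_continuous.
  by apply/funext => y; rewrite /row_eval mpoly.mevalXU.
- rewrite (_ : row_eval _ = row_eval p \+ row_eval q).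
    by apply: continuousD; [exact: cp|exact: cq].
  by apply/funext => y; rewrite /row_eval mpoly.mevalD.
- rewrite (_ : row_eval _ = row_eval p \* row_eval q).
    by apply: continuousM; [exact: cp|exact: cq].
  by apply/funext => y; rewrite /row_eval mpoly.mevalM.
Qed.

Lemma smooth_row_eval p : smooth (row_eval p).
Proof.
move=> s; have [q ->] : exists q, foldr partial (row_eval p) s = row_eval q.
  elim: s => [|i s [q IHs]]; first by exists p.
  exists (mpoly.mderiv i q); apply/funext => x /=; rewrite IHs /partial.
  by have dq := row_eval_derive q i x; rewrite derive_val.
split=> [|i x]; first exact: row_eval_continuous.
by have [] := row_eval_derive q i x.
Qed.

Lemma smooth_sphere_eval p : smooth_on_sphere (@sphere_eval R d p).
Proof. by exists (row_eval p); first exact: smooth_row_eval. Qed.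

End SmoothEval.

(** * Harmonic components of a function *)

Section HarmonicProjection.
Variables (R : realType) (d : nat) (sigma : probability (sphere R d) R).
Hypotheses (d_gt0 : (0 < d)%N) (sigma_inv : rotation_invariant sigma).
Local Notation S := (sphere R d).
Local Notation mpol := (mpoly.mpoly d.+1 R).
Local Notation ev := (@sphere_eval R d).
Implicit Types p q : mpol.

Definition harmonic_mpoly k p : Prop :=
  p \is mpoly.ishomog1 k mpoly.mdeg /\ mlaplacian p = 0.

Lemma harmonic_msize k n p : harmonic_mpoly k p -> (k <= n)%N ->
  (mpoly.msize p <= n.+1)%N.
Proof.
move=> [/mpoly.dhomogP pk _] kn; rewrite mpoly.msizeE.
by apply/bigmax_leqP_seq => m /pk /= -> _.
Qed.

Lemma spherical_harmonicsP k (Y : S -> R) :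
  spherical_harmonics k Y <-> exists2 p, harmonic_mpoly k p & Y = ev p.
Proof. by split=> [[p [pk p0 ->]]|[p [pk p0] ->]]; exists p. Qed.

(** Project f onto the polynomials of degree at most k and keep the component of degree k; the lower
    ones are orthogonal to the harmonics of degree k. *)
Lemma harmonic_proj_exists (f : S -> R) k : f \in Lfun sigma 2%:E ->
  exists2 h, harmonic_mpoly k h &
    forall q, harmonic_mpoly k q -> l2prod sigma f (ev q) = pform sigma h q.
Proof.
move=> Lf.
have bdef p : (mpoly.msize p <= k.+1)%N -> pform sigma p p = 0 -> forall x, ev p x = 0.
  by move=> _; exact: pform_eq0.
have bnull p : (forall x, ev p x = 0) -> pform sigma p p = 0.
  move=> p0; rewrite /pform /l2prod; under eq_Rintegral do rewrite p0 mul0r.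
  by rewrite Rintegral_cst // mul0r.
have [u [_ _ un _ eu]] := orthonormal_basis (pform_sym sigma) (pform_lin sigma)
  (pform_ge0 sigma) bnull bdef.
pose Y := \sum_(w <- u) l2prod sigma f (ev w) *: w.
have Yn : (mpoly.msize Y <= k.+1)%N.
  rewrite /Y big_seq; have [S0 SL] := lin_closed_msize R d.+1 k.+1.
  elim/big_ind: _ => [//|p1 p2 p1n p2n|w wu].
    by rewrite -[p1]scale1r; exact: SL.
  by rewrite -[_ *: _]addr0; apply: SL => //; exact: un.
have [h [hh hE]] := harmonic_decomposition Yn.
exists (h k) => [|q hq]; first exact: hh.
have fq : l2prod sigma f (ev q) = pform sigma Y q.
  rewrite l2prodC /Y (bform_suml (pform_lin sigma)).
  have -> : ev q = fun x => \sum_(w <- u) pform sigma q w * ev w x.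
    by apply/funext => x; rewrite -eu //; exact: harmonic_msize hq _.
  rewrite l2prod_sum //; last by move=> w; exact: ev_L2.
  by apply: eq_bigr => w _; rewrite l2prodC mulrC pform_sym.
rewrite fq; have -> : pform sigma Y q = pform sigma (\sum_(i < k.+1) h i) q.
  rewrite /pform; congr l2prod; apply/funext => x.
  by rewrite hE ev_sum.
rewrite pform_suml (bigD1 ord_max) //= big1 ?addr0 // => i ik.
have [hi hi0] := hh i; have [qk q0] := hq.
apply: (harmonic_orthogonal d_gt0 sigma_inv hi hi0 qk q0).
by apply: contra_neq ik => ik; apply/val_inj.
Qed.

Lemma harmonic_projP (f : S -> R) k : f \in Lfun sigma 2%:E ->
  exists h, [/\ harmonic_mpoly k h, harmonic_proj sigma k f = ev h &
    forall q, harmonic_mpoly k q -> l2prod sigma f (ev q) = pform sigma h q].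
Proof.
move=> Lf.
have minus h q : l2prod sigma f (ev q) - pform sigma h q =
    \int[sigma]_x ((f x - ev h x) * ev q x).
  have -> : \int[sigma]_x ((f x - ev h x) * ev q x) =
      l2prod sigma (fun x => -1 * ev h x + f x) (ev q).
    by apply: eq_Rintegral => x _; rewrite mulN1r addrC.
  by rewrite l2prod_lin ?ev_L2 // mulN1r addrC.
have [h0 hh0 h0E] := harmonic_proj_exists k Lf.
have [|Yk Yorth] := @xgetPex _ (cst 0) [set Y | spherical_harmonics k Y /\
    forall Z, spherical_harmonics k Z ->
      \int[sigma]_x ((f x - Y x) * Z x) = 0].
  exists (ev h0); split; first by apply/spherical_harmonicsP; exists h0.
  by move=> _ /spherical_harmonicsP [q hq ->]; rewrite -minus h0E // subrr.
have /spherical_harmonicsP [h hh hE] := Yk.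
exists h; split=> // q hq; apply/eqP; rewrite -subr_eq0 minus -hE.
by apply/eqP/Yorth/spherical_harmonicsP; exists q.
Qed.

(** Tested against a harmonic of degree k, the distributional series keeps only its k-th term, so
    its partial sums are eventually constant. *)
Lemma frac_laplacian_harmonic (r : R) (f g : S -> R) (h : nat -> mpol) k q :
  (forall k, harmonic_mpoly k (h k) /\ harmonic_proj sigma k f = ev (h k)) ->
  is_frac_laplacian sigma r f g -> harmonic_mpoly k q ->
  l2prod sigma g (ev q) = eigen R d k `^ (r / 2) * pform sigma (h k) q.
Proof.
move=> hh /(_ _ (smooth_sphere_eval q)) gq hq.
apply: (cvg_unique _ gq) => //.
apply: cvg_near_cst; near=> N.
have kN : (k < N)%N by near: N; exact: nbhs_infty_gt.
rewrite /series /= big_mkord (bigD1 (Ordinal kN)) //= big1 => [|i ik].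
  by rewrite addr0 (hh k).2.
rewrite (hh i).2 -[X in _ * X]/(pform sigma (h i) q).
have [[hi hi0] _] := hh i; have [qk q0] := hq.
rewrite (harmonic_orthogonal d_gt0 sigma_inv hi hi0 qk q0) ?mulr0 //.
Unshelve. end_near.
Unshelve. all: by end_near.
Qed.

End HarmonicProjection.

(** * Dyadic decomposition of a Sobolev function *)

Section GeometricLimit.
Variables (R : realType) (t : R).
Hypotheses (t_ge0 : 0 <= t) (t_lt1 : t < 1).

Lemma geometric_small (c e : R) : 0 < e -> exists N, forall j, (N <= j)%N ->
  c * t ^+ j <= e.
Proof.
move=> e0; have t1 : `|t| < 1 by rewrite ger0_norm.
have /cvgrPdist_le /(_ _ e0) [N _ Ne] := cvg_geometric c t1.
exists N => j /Ne; rewrite sub0r normrN; exact: le_trans (ler_norm _).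
Qed.

Lemma le_geometric (a b c : R) : (forall j, exists2 k, (j <= k)%N & a <= b + c * t ^+ k) ->
  a <= b.
Proof.
move=> abc; apply/ler_addgt0Pr => e e0.
have [N Ne] := geometric_small c e0; have [k Nk ak] := abc N.
by rewrite (le_trans ak) // lerD2l Ne.
Qed.

Lemma geometric_sum_le j : \sum_(i < j) t ^+ i <= (1 - t)^-1.
Proof.
have t1 : 0 < 1 - t by rewrite subr_gt0.
rewrite -[leRHS]mul1r ler_pdivlMr // mulrC.
have -> : (1 - t) * \sum_(i < j) t ^+ i = 1 - t ^+ j.
  by rewrite -[RHS]opprB subrX1 -mulNr opprB.
by rewrite lerBlDr lerDl exprn_ge0.
Qed.

Lemma geometric_dist_le (u : nat -> R) (A : R) : 0 <= A ->
  (forall j, `|u j.+1 - u j| <= A * t ^+ j) ->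
  forall j i, `|u (j + i)%N - u j| <= A * t ^+ j / (1 - t).
Proof.
move=> A0 uA j i.
have le_sum : `|u (j + i)%N - u j| <= A * t ^+ j * \sum_(k < i) t ^+ k.
  elim: i => [|i IHi]; first by rewrite addn0 subrr normr0 big_ord0 mulr0.
  rewrite big_ord_recr /= mulrDr addnS.
  rewrite -(subrK (u (j + i)%N) (u (j + i).+1)) -addrA (le_trans (ler_normD _ _)) //.
  by rewrite [X in _ <= X]addrC lerD // -mulrA -exprD.
apply: le_trans le_sum _; apply: ler_wpM2l; last exact: geometric_sum_le.
by rewrite mulr_ge0 // exprn_ge0.
Qed.

Lemma geometric_cvg (u : nat -> R) (A : R) : 0 <= A ->
  (forall j, `|u j.+1 - u j| <= A * t ^+ j) ->
  exists l, forall j, `|l - u j| <= A * t ^+ j / (1 - t).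
Proof.
move=> A0 uA; have t1 : `|t| < 1 by rewrite ger0_norm.
pose v j := u j.+1 - u j.
have cv : cvgn (series v).
  apply: normed_cvg; apply: (series_le_cvg _ _ uA); last exact: is_cvg_geometric_series.
    by move=> j; exact: normr_ge0.
  by move=> j; rewrite /= mulr_ge0 // exprn_ge0.
have sv j : u j = u 0%N + series v j.
  by rewrite /series /= telescope_sumr // addrC subrK.
exists (u 0%N + limn (series v)) => j.
apply/ler_addgt0Pr => e e0.
have /cvgrPdist_le /(_ _ e0) [N _ Ne] := cv.
have := Ne (j + N)%N (leq_addl _ _) => dN.
have dj := geometric_dist_le A0 uA j N.
have -> : u 0%N + limn (series v) - u j =
    (limn (series v) - series v (j + N)%N) + (u (j + N)%N - u j).
  by rewrite [u (j + N)%N]sv; ring.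
by rewrite (le_trans (ler_normD _ _)) // addrC lerD.
Qed.

Lemma uniform_geometric_limit d (P : nat -> sphere R d -> R) (A : R) : 0 <= A ->
  (forall j, continuous (P j)) ->
  (forall j x, `|P j.+1 x - P j x| <= A * t ^+ j) ->
  exists2 F, continuous F & forall j x, `|F x - P j x| <= A / (1 - t) * t ^+ j.
Proof.
move=> A0 cP PA.
have lim x : exists l, forall j, `|l - P j x| <= A / (1 - t) * t ^+ j.
  have [l lE] := geometric_cvg A0 (fun j => PA j x); exists l => j.
  by rewrite mulrAC.
have [F FE] := choice lim; exists F => //= x.
have FFx := @nbhs_filter (sphere R d) x.
apply/(@cvgrPdist_le _ _ _ (nbhs x) FFx) => e e0; have e3 : 0 < e / 3 by rewrite divr_gt0.
have [N /(_ N (leqnn N)) Ne] := geometric_small (A / (1 - t)) e3.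
have /(@cvgrPdist_le _ _ _ (nbhs x) FFx) /(_ _ e3) := cP N x.
apply: (@filterS _ _ FFx) => y Py.
have -> : F x - F y = (F x - P N x) + ((P N x - P N y) - (F y - P N y)) by ring.
have Fx := le_trans (FE x N) Ne; have Fy := le_trans (FE y N) Ne.
have h1 := ler_normD (F x - P N x) ((P N x - P N y) - (F y - P N y)).
have h2 := ler_normB (P N x - P N y) (F y - P N y).
by apply: le_trans h1 _; lra.
Qed.

End GeometricLimit.

Section L2Sup.
Variables (R : realType) (d : nat) (sigma : probability (sphere R d) R).

Lemma l2nrm_le_sup (u : sphere R d -> R) c : continuous u ->
  (forall x, `|u x| <= c) -> l2nrm sigma u <= c.
Proof.
move=> cu uc; have c0 : 0 <= c by apply: le_trans (uc point).
have cc : continuous (fun _ : sphere R d => c * c).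
  by move=> y; exact: cst_continuous.
rewrite /l2nrm -[leRHS]ger0_norm // -sqrtr_sqr ler_wsqrtr //.
have -> : c ^+ 2 = \int[sigma]_x (fun=> c * c) x.
  rewrite Rintegral_cst //.
  by have -> : fine (sigma setT) = 1; rewrite ?probability_setT ?mulr1 // expr2.
apply: le_Rintegral => // [||x _].
- by apply: continuous_integrable; exact: sphere_continuousM.
- exact: continuous_integrable.
- by rewrite -!expr2 -ler_sqrt ?sqr_ge0 // !sqrtr_sqr (ger0_norm c0).
Qed.

End L2Sup.

(** * Decay and summation of the dyadic blocks *)

Section HarmonicBlocks.
Variables (R : realType) (d : nat) (sigma : probability (sphere R d) R).
Hypotheses (d_gt0 : (0 < d)%N) (sigma_inv : rotation_invariant sigma).
Local Notation S := (sphere R d).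
Local Notation mpol := (mpoly.mpoly d.+1 R).
Local Notation ev := (@sphere_eval R d).
Local Notation L2 := (Lfun sigma 2%:E).

Variables (r : R) (f g : S -> R) (h : nat -> mpol).
Hypothesis r_gt : d%:R / 2 < r.
Hypothesis f_cont : continuous f.
Hypothesis g_L2 : g \in L2.
Hypothesis hP : forall k, [/\ harmonic_mpoly k (h k),
  harmonic_proj sigma k f = ev (h k) &
  forall q, harmonic_mpoly k q -> l2prod sigma f (ev q) = pform sigma (h k) q].
Hypothesis fg : is_frac_laplacian sigma r f g.

Lemma pform_harmonic_sum (s : seq nat) (a b : nat -> R) : uniq s ->
  pform sigma (\sum_(k <- s) a k *: h k) (\sum_(k <- s) b k *: h k) =
  \sum_(k <- s) a k * b k * pform sigma (h k) (h k).
Proof.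
move=> us; rewrite (bform_suml (pform_lin sigma)); apply: eq_big_seq => k ks.
rewrite -mulrA; congr (_ * _); rewrite pform_sym (bform_suml (pform_lin sigma)).
rewrite (bigD1_seq k) //= big1 ?addr0 // => j jk.
have [[hj hj0] _ _] := hP j; have [[hk hk0] _ _] := hP k.
by rewrite (harmonic_orthogonal d_gt0 sigma_inv hj hj0 hk hk0 jk) mulr0.
Qed.

Lemma r_gt0 : 0 < r.
Proof. by apply: le_lt_trans r_gt; rewrite divr_ge0. Qed.

Lemma eigen_gt0 k : (0 < k)%N -> 0 < eigen R d k.
Proof.
move=> k0; rewrite /eigen mulr_gt0 ?ltr0n // -addrA ltr_wpDr ?ltr0n //.
by rewrite subr_ge0 ler1n.
Qed.

Lemma eigen_powR_le a k : (0 < a < k)%N ->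
  eigen R d k `^ (- (r / 2)) <= a%:R `^ (- r).
Proof.
move=> /andP[a0 ak]; have r0 := r_gt0.
have a0R : (0 : R) < a%:R by rewrite ltr0n.
rewrite !powRN lef_pV2 ?posrE ?powR_gt0 ?eigen_gt0 ?(leq_ltn_trans _ ak) //.
have -> : r = 2%:R * (r / 2) by field.
rewrite powRrM powR_mulrn ?(ltW a0R) // [2%:R * _]mulrC mulfK ?pnatr_eq0 //.
apply: ge0_ler_powR; rewrite ?nnegrE ?exprn_ge0 ?(ltW a0R) //.
- by rewrite divr_ge0 // ltW.
- exact/ltW/eigen_gt0/(leq_ltn_trans _ ak).
have d1 : 1 <= d%:R :> R by rewrite ler1n.
have : a%:R <= k%:R :> R by rewrite ler_nat ltnW.
rewrite /eigen; move: a0R; nra.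
Qed.

(** Duality: with W the sum of the h_k divided by the eigenvalues to the power r/2, the product of g
    and W is the squared norm of the block Q. Cauchy-Schwarz and |W| <= a^(-r) |Q| then allow
    division by |Q|. *)
Lemma block_bound a b : (0 < a)%N ->
  Num.sqrt (pform sigma (\sum_(k <- index_iota a.+1 b.+1) h k)
    (\sum_(k <- index_iota a.+1 b.+1) h k)) <= a%:R `^ (- r) * l2nrm sigma g.
Proof.
move=> a0; set s := index_iota _ _; set Q := \sum_(k <- s) h k.
have us : uniq s by exact: iota_uniq.
pose c k := eigen R d k `^ (- (r / 2)).
pose W := \sum_(k <- s) c k *: h k.
have QE : Q = \sum_(k <- s) 1 *: h k by apply: eq_bigr => k _; rewrite scale1r.
have sk k : k \in s -> (0 < a < k)%N.
  by rewrite mem_index_iota a0 /= => /andP[].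
have QQ : pform sigma Q Q = \sum_(k <- s) pform sigma (h k) (h k).
  by rewrite {1 2}QE pform_harmonic_sum //; apply: eq_bigr => k _; rewrite !mul1r.
have gW : l2prod sigma g (ev W) = pform sigma Q Q.
  rewrite QQ l2prodC.
  have -> : ev W = fun x => \sum_(k <- s) c k * ev (h k) x.
    by apply/funext => x; rewrite ev_sum; apply: eq_bigr => k _; rewrite evZ.
  rewrite l2prod_sum //; last by move=> k; exact: ev_L2.
  apply: eq_big_seq => k /sk /andP[_ ak]; rewrite l2prodC.
  have hh i : harmonic_mpoly i (h i) /\ harmonic_proj sigma i f = ev (h i).
    by have [] := hP i.
  rewrite (frac_laplacian_harmonic d_gt0 sigma_inv hh fg (hh k).1).
  rewrite mulrA /c powRN mulVf ?mul1r // gt_eqF // powR_gt0 // eigen_gt0 //.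
  exact: leq_ltn_trans ak.
have WW : pform sigma W W <= (a%:R `^ (- r)) ^+ 2 * pform sigma Q Q.
  rewrite pform_harmonic_sum // QQ mulr_sumr big_seq [leRHS]big_seq.
  apply: ler_sum => k /sk ak; rewrite ler_wpM2r ?pform_ge0 //.
  have ck := eigen_powR_le ak.
  by rewrite expr2 ler_pM ?powR_ge0.
have QQ0 : 0 <= pform sigma Q Q by exact: pform_ge0.
have main : pform sigma Q Q <=
    l2nrm sigma g * (a%:R `^ (- r) * Num.sqrt (pform sigma Q Q)).
  rewrite -{1}gW; apply: le_trans (ler_norm _) _.
  apply: le_trans (l2prod_le g_L2 (ev_L2 _ _)) _.
  rewrite ler_wpM2l ?sqrtr_ge0 //.
  apply: le_trans (ler_wsqrtr WW) _.
  by rewrite sqrtrM ?sqr_ge0 // sqrtr_sqr ger0_norm ?powR_ge0.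
set sq := Num.sqrt (pform sigma Q Q) in main *.
have [->|sq0] := eqVneq sq 0; first by rewrite mulr_ge0 ?powR_ge0 ?sqrtr_ge0.
have sqp : 0 < sq by rewrite lt_def sq0 sqrtr_ge0.
rewrite -(ler_pM2r sqp) -[leLHS]expr2 sqr_sqrtr //.
by apply: le_trans main _; rewrite mulrCA mulrA.
Qed.

(** The ratio of consecutive block bounds: the growth 2^(d/2) of the square root of the dimension
    times the gain 2^(-r) of the Sobolev regularity. *)
Definition decay : R := 2 `^ (d%:R / 2 - r).

Lemma decay_gt0 : 0 < decay.
Proof. by rewrite powR_gt0. Qed.

Lemma decay_lt1 : decay < 1.
Proof.
rewrite /decay -opprB powRN invf_lt1 ?powR_gt0 //.
have s0 : 0 < r - d%:R / 2 by rewrite subr_gt0.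
have := @gt0_ltr_powR R _ s0 1 2; rewrite powR1; apply.
- by rewrite nnegrE.
- by rewrite nnegrE.
- by rewrite ltr1n.
Qed.

Section Dyadic.
Variable n : nat.
Hypothesis n_gt0 : (0 < n)%N.

Definition dyadic_sum j : mpol := \sum_(k <- index_iota 0 (2 ^ j * n).+1) h k.
Definition dyadic_block j : mpol :=
  \sum_(k <- index_iota (2 ^ j * n).+1 (2 ^ j.+1 * n).+1) h k.

Lemma dyadic_sumS j : dyadic_sum j.+1 = dyadic_sum j + dyadic_block j.
Proof.
rewrite /dyadic_sum (@big_cat_nat _ _ _ (2 ^ j * n).+1) //=.
by rewrite ltnS leq_pmul2r // leq_exp2l.
Qed.

Lemma msize_harmonic_sum (s : seq nat) N : (forall k, k \in s -> (k <= N)%N) ->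
  (mpoly.msize (\sum_(k <- s) h k)%R <= N.+1)%N.
Proof.
move=> sN; have [S0 SL] := lin_closed_msize R d.+1 N.+1.
rewrite big_seq; elim/big_ind: _ => [//|p1 p2 p1n p2n|k ks].
  by rewrite -[p1]scale1r; exact: SL.
by have [hk _ _] := hP k; exact: harmonic_msize hk (sN k ks).
Qed.

Lemma msize_dyadic_sum j : (mpoly.msize (dyadic_sum j) <= (2 ^ j * n).+1)%N.
Proof. by apply: msize_harmonic_sum => k; rewrite mem_index_iota /= ltnS. Qed.

Lemma msize_dyadic_block j :
  (mpoly.msize (dyadic_block j) <= (2 ^ j.+1 * n).+1)%N.
Proof.
by apply: msize_harmonic_sum => k; rewrite mem_index_iota ltnS => /andP[].
Qed.

Definition dyadic_const : R := n%:R `^ (- r) * l2nrm sigma g.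

Lemma dyadic_const_ge0 : 0 <= dyadic_const.
Proof. by rewrite mulr_ge0 ?powR_ge0 ?sqrtr_ge0. Qed.

(** The common end of the pointwise, sampling and L_2 estimates: c (2^d)^j stands for the growth of
    the dimension from degree n to degree 2^j n. *)
Lemma dyadic_block_bound c j : 0 <= c ->
  Num.sqrt (c * (2 ^+ d) ^+ j * pform sigma (dyadic_block j) (dyadic_block j)) <=
  Num.sqrt c * dyadic_const * decay ^+ j.
Proof.
move=> c0; have n0 : (0 : R) < n%:R by rewrite ltr0n.
have two0 : (0 : R) <= 2 ^+ d by rewrite exprn_ge0.
rewrite !sqrtrM ?mulr_ge0 ?exprn_ge0 // -mulrA -[leRHS]mulrA ler_wpM2l ?sqrtr_ge0 //.
have -> : Num.sqrt ((2 ^+ d) ^+ j) = (2 `^ (d%:R / 2)) ^+ j :> R.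
  rewrite -powR12_sqrt ?exprn_ge0 // powRrM powR_mulrn //.
  by rewrite -[RHS]powR_mulrn ?powR_ge0 // powRAC powR_mulrn ?exprn_ge0.
have -> : decay ^+ j = (2 `^ (d%:R / 2)) ^+ j * (2 `^ (- r)) ^+ j.
  rewrite -exprMn /decay powRD //; apply/implyP => _; by rewrite pnatr_eq0.
rewrite mulrCA ler_wpM2l ?exprn_ge0 ?powR_ge0 //.
have pj : (0 < 2 ^ j * n)%N by rewrite muln_gt0 expn_gt0.
apply: le_trans (block_bound (2 ^ j.+1 * n) pj) _.
rewrite natrM powRM ?ler0n // natrX -powR_mulrn // powRAC powR_mulrn ?powR_ge0 //.
by rewrite /dyadic_const le_eqVlt; apply/orP; left; apply/eqP; ring.
Qed.

(** The constant depends on n, which is harmless: the estimate only yields the uniform convergence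
    in [dyadic_limit]. *)
Lemma dyadic_block_pointwise j x : `|ev (dyadic_block j) x| <=
  Num.sqrt (2 * (4 * n) ^ d)%:R * dyadic_const * decay ^+ j.
Proof.
apply: le_trans (dyadic_block_bound j (ler0n _ _)).
rewrite -sqrtr_sqr ler_wsqrtr //.
apply: le_trans (ev_sqr_le d_gt0 sigma_inv x (msize_dyadic_block j)) _.
rewrite ler_wpM2r ?pform_ge0 // -!natrX -natrM ler_nat.
rewrite -mulnA leq_mul2l /= -expnM (mulnC d) expnM -expnMn leq_exp2r //.
have : (0 < 2 ^ j * n)%N by rewrite muln_gt0 expn_gt0.
by rewrite expnS; move: (2 ^ j)%N => a; nia.
Qed.

(** Here the constant must be free of n. Since n < d (n/d + 1), one has 3 2^j n + 1 <= 4 d 2^j (n/d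
    + 1), whence the factor (4 d)^d 2^(jd) in the quotient of the dimension bounds. *)
Lemma dyadic_block_sampling m (x : 'I_m -> S) (tau : 'I_m -> R) (B : R) j :
  0 <= B -> (forall k, 0 <= tau k) ->
  (forall q, (mpoly.msize q <= n.+1)%N ->
    \sum_k ev q (x k) ^+ 2 * tau k <= B * pform sigma q q) ->
  Num.sqrt (\sum_k ev (dyadic_block j) (x k) ^+ 2 * tau k) <=
  Num.sqrt (B * (2 * (4 * d) ^ d)%:R) * dyadic_const * decay ^+ j.
Proof.
move=> B0 tau0 MZ.
have B1 : 0 <= B * (2 * (4 * d) ^ d)%:R by rewrite mulr_ge0.
apply: le_trans (dyadic_block_bound j B1); rewrite ler_wsqrtr //.
apply: le_trans (sampling_upper_bound d_gt0 sigma_inv B0 tau0 MZ (msize_dyadic_block j)) _.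
rewrite ler_wpM2r ?pform_ge0 // -mulrA ler_wpM2l //.
rewrite ler_pdivrMr ?ltr0n ?expn_gt0 // -!natrX -!natrM ler_nat.
rewrite -!mulnA leq_mul2l /= -expnM (mulnC d j) expnM -!expnMn leq_exp2r //.
have : (0 < 2 ^ j)%N by rewrite expn_gt0.
have := ltn_ceil n d_gt0; rewrite expnS.
move: (n %/ d)%N (2 ^ j)%N => a b; rewrite (mulnC _ d) => nd b0.
have : (b * n <= b * (d * a.+1))%N by rewrite leq_mul2l ltnW ?orbT.
have : (n <= b * n)%N by rewrite leq_pmull.
nia.
Qed.

Lemma dyadic_sum_proj j k q : harmonic_mpoly k q -> (k <= 2 ^ j * n)%N ->
  pform sigma (dyadic_sum j) q = l2prod sigma f (ev q).
Proof.
move=> hq kj; have [_ _ ->] := hP k; last exact: hq.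
rewrite /dyadic_sum pform_suml (bigD1_seq k) ?iota_uniq ?mem_index_iota ?ltnS //=.
rewrite big1 ?addr0 // => i ik; have [[hi hi0] _ _] := hP i; have [qk q0] := hq.
exact: (harmonic_orthogonal d_gt0 sigma_inv hi hi0 qk q0 ik).
Qed.

Lemma dyadic_limit : exists2 c : R, 0 <= c &
  forall j x, `|f x - ev (dyadic_sum j) x| <= c * decay ^+ j.
Proof.
have t0 := ltW decay_gt0; have t1 := decay_lt1.
pose A := Num.sqrt (2 * (4 * n) ^ d)%:R * dyadic_const.
have A0 : 0 <= A by rewrite mulr_ge0 ?sqrtr_ge0 ?dyadic_const_ge0.
have [|j x|F cF FE] := uniform_geometric_limit t0 t1
    (P := fun j => ev (dyadic_sum j)) A0.
- by move=> j; exact: sphere_eval_continuous.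
- by rewrite dyadic_sumS evD addrC addKr; exact: dyadic_block_pointwise.
pose c := A / (1 - decay); have c0 : 0 <= c by rewrite divr_ge0 // subr_ge0 ltW.
suff fF x : f x = F x by exists c => // j x; rewrite fF; exact: FE.
apply/eqP; rewrite -subr_eq0; apply/eqP.
have cN (u : S -> R) : continuous u -> continuous (fun x => - 1 * u x).
  move=> cu; apply: sphere_continuousM => // y; exact: cst_continuous.
have cfF : continuous (fun x => f x - F x).
  rewrite (_ : (fun _ => _) = fun x => f x + -1 * F x).
    by apply: sphere_continuousD => //; exact: cN.
  by apply/funext => y; rewrite mulN1r.
apply: (continuous_orthogonal_poly sigma_inv d_gt0 cfF) => p.
pose N := mpoly.msize p; have [q [hq pE]] := harmonic_decomposition (leqnSn N : (mpoly.msize p <= N.+1)%N).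
have Lf := continuous_L2 sigma f_cont; have LF := continuous_L2 sigma cF.
(* All harmonic components of p have degree at most N <= 2^j n, hence are already seen by the dyadic
   sum. *)
have fp j : (N <= j)%N -> l2prod sigma f (ev p) = pform sigma (dyadic_sum j) p.
  move=> Nj; have Nj2 : (N <= 2 ^ j * n)%N.
    by rewrite (leq_trans Nj) // (leq_trans (ltnW (ltn_expl j (ltnSn 1)))) // leq_pmulr.
  have evp : ev p = ev (\sum_(k < N.+1) q k).
    by apply/funext => y; rewrite pE ev_sum.
  rewrite /pform evp -/(pform _ _ _) pform_sym pform_suml l2prodC.
  have -> : ev (\sum_(k < N.+1) q k) = fun y => \sum_(k < N.+1) 1 * ev (q k) y.
    by apply/funext => y; rewrite ev_sum; apply: eq_bigr => k _; rewrite mul1r.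
  rewrite l2prod_sum //; last by move=> k; exact: ev_L2.
  apply: eq_bigr => k _; rewrite mul1r l2prodC pform_sym (dyadic_sum_proj (hq k)) //.
  by rewrite (leq_trans _ Nj2) // -ltnS.
have lin (u v : S -> R) : u \in L2 -> v \in L2 ->
    \int[sigma]_y ((u y - v y) * ev p y) = l2prod sigma u (ev p) - l2prod sigma v (ev p).
  move=> Lu Lv; rewrite -[RHS]addrC -mulN1r -l2prod_lin ?ev_L2 //.
  by apply: eq_Rintegral => y _; rewrite mulN1r addrC.
(* Against p, f may be replaced by any late dyadic sum, which is uniformly close to F. *)
rewrite lin //; apply/eqP; rewrite -normr_le0; apply: (le_geometric t0 t1 (c := l2nrm sigma (ev p) * c)) => j.
exists (N + j)%N; first exact: leq_addl.
rewrite add0r (fp (N + j)%N (leq_addr _ _)) -lin ?ev_L2 //.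
have cSF : continuous (fun y => ev (dyadic_sum (N + j)) y - F y).
  rewrite (_ : (fun _ => _) = fun y => ev (dyadic_sum (N + j)) y + -1 * F y).
    by apply: sphere_continuousD; [exact: sphere_eval_continuous|exact: cN].
  by apply/funext => y; rewrite mulN1r.
have /le_trans := l2prod_le (continuous_L2 sigma cSF) (ev_L2 sigma p); apply.
rewrite mulrC -mulrA.
rewrite ler_wpM2l ?sqrtr_ge0 // l2nrm_le_sup // => y.
by rewrite distrC; exact: FE.
Qed.

(* The seminorm is applied both to the norm of L_2 and to the discrete one. *)
Lemma dyadic_tail_bound (Nm : (S -> R) -> R) (b K : R) :
  (forall u v, continuous u -> continuous v ->
     Nm (fun x => u x + v x) <= Nm u + Nm v) ->
  (forall u c, continuous u -> 0 <= c -> (forall x, `|u x| <= c) -> Nm u <= K * c) ->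
  (forall j, Nm (ev (dyadic_block j)) <= b * decay ^+ j) -> 0 <= b ->
  Nm (fun x => f x - ev (dyadic_sum 0) x) <= b / (1 - decay).
Proof.
move=> NmD NmK Nmb b0; have t0 := ltW decay_gt0; have t1 := decay_lt1.
have [c c0 fS] := dyadic_limit.
have cB (u : S -> R) p : continuous u -> continuous (fun x => u x - ev p x).
  move=> cu; rewrite (_ : (fun _ => _) = fun x => u x + -1 * ev p x).
    apply: sphere_continuousD => //; apply: sphere_continuousM.
      by move=> y; exact: cst_continuous.
    exact: sphere_eval_continuous.
  by apply/funext => y; rewrite mulN1r.
have partial j : Nm (fun x => f x - ev (dyadic_sum 0) x) <=
    Nm (fun x => f x - ev (dyadic_sum j) x) + b * \sum_(i < j) decay ^+ i.
  elim: j => [|j IHj]; first by rewrite big_ord0 mulr0 addr0.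
  apply: le_trans IHj _; rewrite big_ord_recr /= mulrDr addrCA [X in X <= _]addrC lerD2l.
  rewrite (_ : (fun x => f x - ev (dyadic_sum j) x) =
      fun x => (f x - ev (dyadic_sum j.+1) x) + ev (dyadic_block j) x); last first.
    by apply/funext => x; rewrite dyadic_sumS evD; ring.
  apply: le_trans (NmD _ _ (cB _ _ f_cont) (@sphere_eval_continuous _ _ _)) _.
  by rewrite lerD2l.
(* The remainder after j blocks tends to 0 uniformly, hence for [Nm], which is dominated by the sup
   norm. *)
apply: (le_geometric t0 t1 (c := K * c)) => j; exists j => //.
apply: le_trans (partial j) _; rewrite addrC lerD //.
  by rewrite ler_wpM2l // geometric_sum_le.
rewrite -mulrA NmK //; first exact: cB.
by rewrite mulr_ge0 // exprn_ge0.
Qed.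

End Dyadic.

End HarmonicBlocks.

(** * Least squares *)

Section LeastSquares.
Variables (R : realType) (d : nat) (sigma : probability (sphere R d) R).
Hypotheses (d_gt0 : (0 < d)%N) (sigma_inv : rotation_invariant sigma).
Local Notation S := (sphere R d).
Local Notation mpol := (mpoly.mpoly d.+1 R).
Local Notation ev := (@sphere_eval R d).

Variables (n m : nat) (x : 'I_m -> S) (tau : 'I_m -> R) (A : R).
Hypothesis tau_ge0 : forall k, 0 <= tau k.
Hypothesis A_gt0 : 0 < A.
Hypothesis lower_MZ : forall p, (mpoly.msize p <= n.+1)%N ->
  A * pform sigma p p <= lsq_inner x tau (ev p) (ev p).

Local Notation inner := (lsq_inner x tau).

Lemma lsq_inner_sym (u v : S -> R) : inner u v = inner v u.
Proof. by apply: eq_bigr => k _; rewrite mulrAC. Qed.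

Lemma lsq_inner_lin a (u v w : S -> R) :
  inner (a *: u + v) w = a * inner u w + inner v w.
Proof.
rewrite /lsq_inner mulr_sumr -big_split; apply: eq_bigr => k _.
by rewrite /= -[(a *: u + v) _]/(a * u (x k) + v (x k)); ring.
Qed.

Lemma lsq_inner_ge0 (u : S -> R) : 0 <= inner u u.
Proof.
by apply: sumr_ge0 => k _; rewrite -mulrA -expr2 mulr_ge0 ?sqr_ge0.
Qed.

Lemma lsq_errorE (u v : S -> R) :
  lsq_error x tau u v = inner (-1 *: v + u) (-1 *: v + u).
Proof.
apply: eq_bigr => k _; rewrite real_normK ?num_real //.
by rewrite -[(-1 *: v + u) _]/(-1 * v (x k) + u (x k)); ring.
Qed.

Definition lsq_pform (p q : mpol) : R := inner (ev p) (ev q).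

Lemma lsq_pform_lin a p q h :
  lsq_pform (a *: p + q) h = a * lsq_pform p h + lsq_pform q h.
Proof.
rewrite /lsq_pform -lsq_inner_lin; congr inner; apply/funext => y.
by rewrite evD evZ.
Qed.

Lemma spherical_polynomialsP (P : S -> R) : spherical_polynomials n P <->
  exists2 p, (mpoly.msize p <= n.+1)%N & P = ev p.
Proof. by split=> -[p pn ->]; exists p. Qed.

Lemma lsq_null p : (mpoly.msize p <= n.+1)%N -> lsq_pform p p = 0 ->
  forall y, ev p y = 0.
Proof.
move=> pn p0; apply: (pform_eq0 d_gt0 sigma_inv); apply/eqP.
rewrite eq_le pform_ge0 andbT -(pmulr_rle0 _ A_gt0).
by rewrite (le_trans (lower_MZ pn)) // -[lsq_inner _ _ _ _]/(lsq_pform p p) p0.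
Qed.

Lemma lsq_kernelP y : spherical_polynomials n (lsq_kernel n x tau ^~ y) /\
  forall P, spherical_polynomials n P -> P y = inner P (lsq_kernel n x tau ^~ y).
Proof.
have b0 p : (forall y, ev p y = 0) -> lsq_pform p p = 0.
  by move=> p0; rewrite /lsq_pform /lsq_inner big1 // => k _; rewrite p0 mulr0.
have [M [K [_ Kn Krep _]]] := reproducing_kernel
  (fun p q => lsq_inner_sym (ev p) (ev q)) lsq_pform_lin
  (fun p => lsq_inner_ge0 (ev p)) b0 lsq_null.
move: y; apply: (@xgetPex _ (fun _ _ => 0) [set D | forall y : S,
    spherical_polynomials n (D^~ y) /\
    forall P, spherical_polynomials n P -> P y = inner P (D^~ y)]).
exists (fun z y => ev (K y) z) => y; split.
  by apply/spherical_polynomialsP; exists (K y).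
by move=> _ /spherical_polynomialsP [p pn ->]; exact: Krep.
Qed.

Section Approximation.
Variable f : S -> R.

(** The kernel formula yields a polynomial that satisfies the normal equations and whose integral is
    the quadrature; [lsq_approxP] identifies it with the minimizer. *)
Lemma lsq_solution : exists q, [/\ (mpoly.msize q <= n.+1)%N,
    lsq_quadrature sigma n x tau f = \int[sigma]_y ev q y &
    forall p, (mpoly.msize p <= n.+1)%N -> inner (ev q) (ev p) = inner f (ev p)].
Proof.
have dk k : {p | (mpoly.msize p <= n.+1)%N & lsq_kernel n x tau ^~ (x k) = ev p}.
  apply: cid2; apply/spherical_polynomialsP; exact: (lsq_kernelP (x k)).1.
pose D k : mpol := s2val (dk k).
have Dn k : (mpoly.msize (D k) <= n.+1)%N := s2valP (dk k).
have DE k : lsq_kernel n x tau ^~ (x k) = ev (D k) := s2valP' (dk k).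
pose q := \sum_k (tau k * f (x k)) *: D k.
exists q; split.
- have [S0 SL] := lin_closed_msize R d.+1 n.+1.
  rewrite /q; elim/big_ind: _ => [//|p1 p2 p1n p2n|k _].
    by rewrite -[p1]scale1r; exact: SL.
  by rewrite -[_ *: _]addr0; exact: SL.
- rewrite Rintegral_ev (bform_suml (pform_lin sigma)).
  apply: eq_bigr => k _; rewrite -Rintegral_ev /lsq_weight -DE.
  by rewrite mulrAC.
- move=> p pn; rewrite -/(lsq_pform q p) (bform_suml lsq_pform_lin).
  apply: eq_bigr => k _; congr (_ * _).
  have [_ ->] := lsq_kernelP (x k); last by apply/spherical_polynomialsP; exists p.
  by rewrite /lsq_pform -DE lsq_inner_sym.
Qed.

(** By Pythagoras the error of p is that of q plus the squared sampling norm of p - q. This gives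
    the minimality of q, its uniqueness through the lower inequality, and the final estimate. *)
Lemma lsq_approxP : exists q, [/\ (mpoly.msize q <= n.+1)%N,
    lsq_approx n x tau f = ev q,
    lsq_quadrature sigma n x tau f = \int[sigma]_y ev q y &
    forall p, (mpoly.msize p <= n.+1)%N ->
      lsq_pform (-1 *: q + p) (-1 *: q + p) <= lsq_error x tau f (ev p)].
Proof.
have [q [qn quad q_orth]] := lsq_solution.
have [S0 SL] := lin_closed_msize R d.+1 n.+1.
have pyth p : (mpoly.msize p <= n.+1)%N -> lsq_error x tau f (ev p) =
    lsq_error x tau f (ev q) + lsq_pform (-1 *: q + p) (-1 *: q + p).
  move=> pn; rewrite !lsq_errorE.
  have := q_orth _ pn; have := q_orth _ qn.
  rewrite /lsq_pform; have -> : ev (-1 *: q + p) = -1 *: ev q + ev p.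
    by apply/funext => y; rewrite evD evZ.
  rewrite !lsq_inner_lin ![inner _ (_ + _)]lsq_inner_sym !lsq_inner_lin.
  rewrite (lsq_inner_sym (ev p) (ev q)) (lsq_inner_sym (ev p) f).
  rewrite (lsq_inner_sym (ev q) f) => -> ->; ring.
have min p : (mpoly.msize p <= n.+1)%N ->
    lsq_error x tau f (ev q) <= lsq_error x tau f (ev p).
  by move=> pn; rewrite (pyth p) // lerDl lsq_inner_ge0.
exists q; split=> // [|p pn]; last first.
  by rewrite (pyth p) // lerDr lsq_errorE lsq_inner_ge0.
have [|/spherical_polynomialsP [p pn pE] pmin] := @xgetPex _ (cst 0)
    [set P | spherical_polynomials n P /\ forall Q, spherical_polynomials n Q ->
      lsq_error x tau f P <= lsq_error x tau f Q].
  exists (ev q); split; first by apply/spherical_polynomialsP; exists q.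
  by move=> _ /spherical_polynomialsP [p pn ->]; exact: min.
rewrite /lsq_approx pE; apply/funext => y.
have sn : (mpoly.msize (-1 *: q + p)%R <= n.+1)%N by exact: SL.
suff s0 : lsq_pform (-1 *: q + p) (-1 *: q + p) = 0.
  have := lsq_null sn s0 y; rewrite evD evZ mulN1r addrC => /eqP.
  by rewrite subr_eq0 => /eqP.
apply/eqP; rewrite eq_le lsq_inner_ge0 andbT.
have := pmin (ev q); rewrite pE (pyth p) // gerDl; apply.
by apply/spherical_polynomialsP; exists q.
Qed.

End Approximation.

End LeastSquares.

(** * Error of the least squares approximation *)

Section ErrorBounds.
Variables (R : realType) (d : nat) (sigma : probability (sphere R d) R).
Hypotheses (d_gt0 : (0 < d)%N) (sigma_inv : rotation_invariant sigma).
Local Notation S := (sphere R d).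
Local Notation mpol := (mpoly.mpoly d.+1 R).
Local Notation ev := (@sphere_eval R d).

Definition sampling_const : R := (2 * (4 * d) ^ d)%:R.

Lemma lsq_error_bound (r : R) (f g : S -> R) n m (x : 'I_m -> S)
    (tau : 'I_m -> R) (A B : R) :
  d%:R / 2 < r -> continuous f -> g \in Lfun sigma 2%:E ->
  is_frac_laplacian sigma r f g -> (0 < n)%N ->
  (forall k, 0 <= tau k) -> 0 < A -> 0 <= B ->
  (forall p, (mpoly.msize p <= n.+1)%N ->
    A * pform sigma p p <= lsq_inner x tau (ev p) (ev p) /\
    lsq_inner x tau (ev p) (ev p) <= B * pform sigma p p) ->
  exists2 q, [/\ (mpoly.msize q <= n.+1)%N, lsq_approx n x tau f = ev q &
    lsq_quadrature sigma n x tau f = \int[sigma]_y ev q y] &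
  l2nrm sigma (fun y => f y - ev q y) <=
    (1 + Num.sqrt sampling_const) / (1 - decay d r) * (1 + Num.sqrt (B / A)) *
    n%:R `^ (- r) * l2nrm sigma g.
Proof.
move=> r_gt f_cont g_L2 fg n0 tau0 A0 B0 MZ.
have f_L2 := continuous_L2 sigma f_cont.
have [h hP] := choice (fun k => harmonic_projP d_gt0 sigma_inv k f_L2).
have [q [qn qE quad qmin]] := lsq_approxP d_gt0 sigma_inv tau0 A0
  (fun p pn => (MZ p pn).1) f.
exists q; first by split.
pose c := dyadic_const sigma r g n; have c0 : 0 <= c := dyadic_const_ge0 _ _ _ _.
pose t := decay d r.
have t1 : 0 < 1 - t by rewrite subr_gt0 decay_lt1.
pose p := dyadic_sum h n 0.
have pn : (mpoly.msize p <= n.+1)%N.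
  by have := msize_dyadic_sum hP n 0; rewrite mul1n.
have bound2 : l2nrm sigma (fun y => f y - ev p y) <= c / (1 - t).
  apply: (@dyadic_tail_bound _ _ _ d_gt0 sigma_inv _ _ _ _ r_gt f_cont g_L2 hP fg
    _ n0 _ _ 1) => //.
  - by move=> u v cu cv; apply: l2nrmD; exact: continuous_L2.
  - by move=> u e cu _ ue; rewrite mul1r; exact: l2nrm_le_sup.
  (* In L_2 there is no loss of dimension; the factor (2^d)^j >= 1 is inserted to get the same ratio
     as for the sampling norm. *)
  - move=> j; rewrite -[c]mul1r -{1}sqrtr1.
    apply: le_trans (dyadic_block_bound d_gt0 sigma_inv r_gt g_L2 hP fg n0 j ler01).
    rewrite ler_wsqrtr // mul1r ler_peMl ?pform_ge0 //.
    by rewrite exprn_ege1 // exprn_ege1 // ler1n.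
pose Nm (u : S -> R) := Num.sqrt (lsq_inner x tau u u).
have C0 : 0 <= sampling_const := ler0n _ _.
have bound_mu : Nm (fun y => f y - ev p y) <= Num.sqrt (B * sampling_const) * c / (1 - t).
  apply: (@dyadic_tail_bound _ _ _ d_gt0 sigma_inv _ _ _ _ r_gt f_cont g_L2 hP fg
    _ n0 _ _ (Num.sqrt (\sum_k tau k))) => //.
  - move=> u v _ _; exact: (bform_triangle (lsq_inner_sym x tau)
      (lsq_inner_lin x tau) (lsq_inner_ge0 x tau0) u v).
  - move=> u e _ e0 ue; rewrite /Nm.
    rewrite -[X in _ <= _ * X](ger0_norm e0) -sqrtr_sqr -sqrtrM ?sumr_ge0 //.
    rewrite ler_wsqrtr // mulr_suml; apply: ler_sum => k _.
    rewrite -mulrA ler_wpM2l // -expr2 -(@real_normK _ (u (x k))) ?num_real //.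
    by rewrite lerXn2r ?nnegrE.
  - move=> j; rewrite /Nm; have -> : lsq_inner x tau (ev (dyadic_block h n j))
        (ev (dyadic_block h n j)) = \sum_k ev (dyadic_block h n j) (x k) ^+ 2 * tau k.
      by apply: eq_bigr => k _; ring.
    apply: (dyadic_block_sampling d_gt0 sigma_inv r_gt g_L2 hP fg n0 j B0 tau0) => s sn.
    apply: le_trans (MZ s sn).2; rewrite le_eqVlt; apply/orP; left; apply/eqP.
    by apply: eq_bigr => k _; ring.
  - by rewrite mulr_ge0 ?sqrtr_ge0.
pose s := -1 *: q + p.
have sn : (mpoly.msize s <= n.+1)%N by exact: (lin_closed_msize _ _ _).2.
have bound_s : l2nrm sigma (ev s) <=
    Num.sqrt (B / A) * Num.sqrt sampling_const * c / (1 - t).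
  have errE : lsq_error x tau f (ev p) = lsq_inner x tau (fun y => f y - ev p y)
      (fun y => f y - ev p y).
    by apply: eq_bigr => k _; rewrite real_normK ?num_real //; ring.
  have As : A * pform sigma s s <= lsq_error x tau f (ev p).
    exact: le_trans (MZ s sn).1 (qmin p pn).
  have sAs : Num.sqrt A * l2nrm sigma (ev s) <= Num.sqrt (B * sampling_const) * c / (1 - t).
    apply: le_trans bound_mu; rewrite /Nm -errE /l2nrm -sqrtrM ?(ltW A0) //.
    by rewrite ler_wsqrtr.
  (* Division by the square root of A turns the factor sqrt B of the sampling bound into the square
     root of the condition number. *)
  have sA : 0 < Num.sqrt A by rewrite sqrtr_gt0.
  rewrite -(ler_pM2l sA); apply: le_trans sAs _.
  rewrite !mulrA -sqrtrM ?(ltW A0) // [A * _]mulrC divfK ?gt_eqF //.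
  by rewrite sqrtrM.
have fq : (fun y => f y - ev q y) = fun y => (f y - ev p y) + ev s y.
  by apply/funext => y; rewrite /s evD evZ; ring.
have cfp : continuous (fun y => f y - ev p y).
  rewrite (_ : (fun _ => _) = fun y => f y + ev (- p) y).
    by apply: sphere_continuousD => //; exact: sphere_eval_continuous.
  by apply/funext => y; rewrite /sphere_eval mpoly.mevalN.
rewrite fq; apply: le_trans (l2nrmD (continuous_L2 sigma cfp) (ev_L2 sigma s)) _.
apply: le_trans (lerD bound2 bound_s) _.
have k0 : 0 <= Num.sqrt (B / A) by exact: sqrtr_ge0.
have s0 : 0 <= Num.sqrt sampling_const by exact: sqrtr_ge0.
have -> : (1 + Num.sqrt sampling_const) / (1 - decay d r) * (1 + Num.sqrt (B / A)) *
    n%:R `^ (- r) * l2nrm sigma g =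
    (1 + Num.sqrt sampling_const) * (1 + Num.sqrt (B / A)) * (c / (1 - t)).
  by rewrite /c /dyadic_const /t; ring.
have -> : c / (1 - t) + Num.sqrt (B / A) * Num.sqrt sampling_const * c / (1 - t) =
    (1 + Num.sqrt (B / A) * Num.sqrt sampling_const) * (c / (1 - t)) by ring.
rewrite ler_wpM2r ?divr_ge0 ?(ltW t1) //.
by have := mulr_ge0 k0 s0; lra.
Qed.

End ErrorBounds.

Theorem theorem4p6 (R : realType) (d : nat) (hd : (0 < d)%N)
    (sigma : probability (sphere R d) R) (hsigma : rotation_invariant sigma)
    (r : R) (hr : d%:R / 2 < r) :
  exists2 C : R, 0 < C &
    forall (l : nat -> nat) (x : forall n, 'I_(l n) -> sphere R d)
      (tau : forall n, 'I_(l n) -> R) (A B kappa : R),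
    MZ_family sigma x tau A B -> kappa = B / A ->
    forall f : sphere R d -> R, continuous f -> sobolev sigma r f ->
    forall n : nat, (0 < n)%N ->
      (l2norm sigma (f \- lsq_approx n (x n) (tau n) f)%R
         <= (C * (1 + Num.sqrt kappa) * n%:R `^ (- r))%:E
              * sobolev_norm sigma r f)%E /\
      (`|\int[sigma]_y f y - lsq_quadrature sigma n (x n) (tau n) f|%:E
         <= (C * (1 + Num.sqrt kappa) * n%:R `^ (- r))%:E
              * sobolev_norm sigma r f)%E.
Proof.
pose C : R := (1 + Num.sqrt (sampling_const R d)) / (1 - decay d r).
have C0 : 0 < C.
  by rewrite divr_gt0 ?subr_gt0 ?decay_lt1 // ltr_pwDl // sqrtr_ge0.
exists C => // l x tau A B kappa [_ tau0 A0 B0 MZ] -> f f_cont [f_L2 f_fin] n n0.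
have tau_ge0 k : 0 <= tau n k by exact: ltW (tau0 n k n0).
have MZn p : (mpoly.msize p <= n.+1)%N ->
    A * pform sigma p p <= lsq_inner (x n) (tau n) (sphere_eval p) (sphere_eval p) /\
    lsq_inner (x n) (tau n) (sphere_eval p) (sphere_eval p) <= B * pform sigma p p.
  move=> pn; have pP : spherical_polynomials n (@sphere_eval R d p) by exists p.
  have := MZ n _ n0 pP; rewrite (l2norm_l2nrm (ev_L2 sigma p)).
  rewrite -EFin_expe -!EFinM !lee_fin /l2nrm sqr_sqrtr ?l2prod_ge0 //.
  have -> : \sum_(k < l n) `|sphere_eval p (x n k)| ^+ 2 * tau n k =
      lsq_inner (x n) (tau n) (sphere_eval p) (sphere_eval p).
    by apply: eq_bigr => k _; rewrite real_normK ?num_real //; ring.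
  by move=> /andP[].
set K := C * _ * _.
have K0 : 0 < K.
  have k1 : 0 < 1 + Num.sqrt (B / A) by rewrite ltr_pwDl // sqrtr_ge0.
  by apply: mulr_gt0 (mulr_gt0 C0 k1) _; apply: powR_gt0; rewrite ltr0n.
(* The Sobolev norm contains an infimum over the representatives g, so a bound by the norm of each g
   is enough. *)
have le_sobolev X : (forall g, g \in Lfun sigma 2%:E ->
    is_frac_laplacian sigma r f g -> X <= K * l2nrm sigma g) ->
    (X%:E <= K%:E * sobolev_norm sigma r f)%E.
  move=> Xg; have -> : X = K * (X / K) by rewrite mulrC divfK // gt_eqF.
  rewrite EFinM lee_pmul2l ?lte_fin // /sobolev_norm -[leLHS]add0e.
  apply: leeD; first exact: Lnorm_ge0.
  apply: le_ereal_inf_tmp => _ [g [g_L2 fg] <-].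
  by rewrite l2norm_l2nrm // lee_fin ler_pdivrMr // mulrC; exact: Xg.
have [q [qn qE quadE _]] := lsq_approxP hd hsigma tau_ge0 A0
  (fun p pn => (MZn p pn).1) f.
have err_L2 : f \- lsq_approx n (x n) (tau n) f \in Lfun sigma 2%:E.
  rewrite qE (_ : _ \- _ = fun y => -1 * sphere_eval q y + f y).
    by apply: L2_lin => //; exact: ev_L2.
  by apply/funext => y /=; ring.
(* The quadrature is the integral of the approximant, so its error is the integral of f minus the
   approximant, at most the L_2 norm since sigma has mass 1. *)
have quad_le : `|\int[sigma]_y f y - lsq_quadrature sigma n (x n) (tau n) f| <=
    l2nrm sigma (f \- lsq_approx n (x n) (tau n) f).
  rewrite quadE -RintegralB //; last 2 first.
  - exact: continuous_integrable.
  - exact: ev_integrable.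
  by move: err_L2; rewrite qE => /Rintegral_le_l2nrm.
have err_le g : g \in Lfun sigma 2%:E -> is_frac_laplacian sigma r f g ->
    l2nrm sigma (f \- lsq_approx n (x n) (tau n) f) <= K * l2nrm sigma g.
  move=> g_L2 fg; have [p [_ -> _] pb] := lsq_error_bound hd hsigma hr f_cont
    g_L2 fg n0 tau_ge0 A0 (ltW B0) MZn.
  exact: pb.
split.
  by rewrite l2norm_l2nrm //; exact: le_sobolev.
by apply: le_sobolev => g g_L2 fg; apply: le_trans quad_le _; exact: err_le.
Qed.
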